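(* For $|\lambda|\le1$ let $C_{(\lambda)}$ be the copula with density $$c(u,v)=1+\lambda\,\mathrm{sign}(2u-1)\,\mathrm{sign}(2v-1),\qquad (u,v)\in[0,1]^2,$$ and put $C_1=C_{(1)}$, $C_2=C_{(-1)}$. Then: (1) $C_{(\lambda)}=\frac{1+\lambda}{2}C_1+\frac{1-\lambda}{2}C_2$, and $C_{(\lambda)}$ generates $\psi$-mixing Markov chains for $|\lambda|<1$. (2) Neither $C_1$ nor $C_2$ has a density bounded away from zero on a set of Lebesgue measure $1$, and neither generates $\rho$-mixing or $\psi'$-mixing Markov chains with continuous marginal distributions; but their convex combinations $C_{(\lambda)}$ with $|\lambda|<1$ generate $\psi'$-mixing (hence $\rho$-mixing) Markov chains. (3) Neither $C_1$ nor $C_2$ generates $\psi$-mixing Markov chains, but $C_{(\lambda)}$ with $|\lambda|<1$ does. (4) Neither $C_1$ nor $C_2$ generates $\phi$-mixing Markov chains, but $C_{(\lambda)}$ with $|\lambda|<1$ does. (5) Neither $C_1$ nor $C_2$ generates $\beta$-mixing Markov chains, but $C_{(\lambda)}$ with $|\lambda|<1$ does.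
   Context: The stationary Markov chain $(X_n)_{n\ge0}$ generated by a copula $C$ and a continuous marginal distribution function $F$ has $X_n\sim F$ and $(F(X_n),F(X_{n+1}))$ with joint distribution function $C$. With $P(A)=P(X_0\in A)$, $P^n(A\cap B)=P(X_0\in A,X_n\in B)$ and $P^n(B|A)=P(X_n\in B\mid X_0\in A)$ for Borel sets $A,B$: $$\phi_n=\sup_{P(A)P(B)>0}|P^n(B|A)-P(B)|,\quad \rho_n=\sup_f\{|\mathbb{E}(f(X_0)f(X_n))|:\mathbb{E}f(X_0)=0,\ \mathbb{E}f^2(X_0)=1\},$$ $$\psi_n=\sup_{P(A)P(B)>0}\frac{|P^n(A\cap B)-P(A)P(B)|}{P(A)P(B)},\qquad \psi'_n=\inf_{P(A)P(B)>0}\frac{P^n(A\cap B)}{P(A)P(B)},$$ and $\beta_n$ is the usual absolute regularity coefficient, $\beta_n=\mathbb{E}\bigl[\sup_B|P(X_n\in B\mid X_0)-P(B)|\bigr]$. The chain is $\phi$-, $\rho$-, $\psi$-, $\beta$-mixing if the corresponding coefficient tends to $0$, and $\psi'$-mixing if $\psi'_n\to1$. *)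

(* Defs.v *)
From HB Require Import structures.
From mathcomp Require Import all_boot all_order all_algebra.
From mathcomp Require Import all_classical all_reals all_analysis.
From mathcomp Require Import measurable_realfun.
Import Order.TTheory GRing.Theory Num.Theory.
Import numFieldNormedType.Exports.

Set Implicit Arguments.
Unset Strict Implicit.
Unset Printing Implicit Defensive.

Local Open Scope classical_set_scope.
Local Open Scope ring_scope.


(* A copula is only relevant on [0, 1]^2; its values elsewhere are junk. *)
Definition is_copula (R : realType) (C : R -> R -> R) : Prop :=
  [/\ forall u, u \in `[0, 1] -> C u 0 = 0 /\ C 0 u = 0,
      forall u, u \in `[0, 1] -> C u 1 = u /\ C 1 u = u &
      forall u u' v v', 0 <= u -> u <= u' -> u' <= 1 ->
        0 <= v -> v <= v' -> v' <= 1 ->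
        0 <= C u' v' - C u v' - C u' v + C u v].

Definition lebesgue2 (R : realType) :=
  (@lebesgue_measure R \x @lebesgue_measure R)%E.

Definition unit_square (R : realType) : set (R * R) :=
  `[0, 1]%classic `*` `[0, 1]%classic.

Definition has_density (R : realType) (C : R -> R -> R) (c : R * R -> R)
    : Prop :=
  [/\ measurable_fun (@unit_square R) c,
      forall z, unit_square z -> 0 <= c z &
      forall u v, u \in `[0, 1] -> v \in `[0, 1] ->
        (C u v)%:E =
          (\int[@lebesgue2 R]_(z in `[0%R, u]%classic `*` `[0%R, v]%classic)
             (c z)%:E)%E].

Definition has_density_bounded_away_from_0 (R : realType) (C : R -> R -> R)
    : Prop :=
  exists c, has_density C c /\
  exists (eps : R) (S : set (R * R)),
    [/\ 0 < eps, measurable S, S `<=` @unit_square R,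
        (@lebesgue2 R S = 1)%E & forall z, S z -> eps <= c z].

Definition sign_density (R : realType) (lambda : R) (z : R * R) : R :=
  1 + lambda * Num.sg (2 * z.1 - 1) * Num.sg (2 * z.2 - 1).

Definition sign_copula (R : realType) (lambda u v : R) : R :=
  \int[@lebesgue2 R]_(z in `[0%R, u]%classic `*` `[0%R, v]%classic)
    sign_density lambda z.


Definition sigma_of (R : realType) d (T : measurableType d)
    (P : probability T R) (X : nat -> {RV P >-> R}) (J : set nat)
    : set (set T) :=
  <<s [set A | exists i (B : set R),
         [/\ J i, measurable B & A = X i @^-1` B]] >>.

(* h is a version of the conditional probability P(E | G). *)
Definition is_cond_prob (R : realType) d (T : measurableType d)
    (P : probability T R) (G : set (set T)) (E : set T) (h : T -> \bar R)
    : Prop :=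
  [/\ forall B : set (\bar R), measurable B -> G (h @^-1` B),
      P.-integrable setT h &
      forall D, G D -> (\int[P]_(w in D) h w = P (D `&` E))%E].

(* P(X_{n+1} in B | X_0, ..., X_n) = P(X_{n+1} in B | X_n) almost surely:
   the two conditional probabilities have a common version. *)
Definition is_markov (R : realType) d (T : measurableType d)
    (P : probability T R) (X : nat -> {RV P >-> R}) : Prop :=
  forall n (B : set R), measurable B -> exists h,
    is_cond_prob P (sigma_of X [set i | (i <= n)%N]) (X n.+1 @^-1` B) h /\
    is_cond_prob P (sigma_of X [set n]) (X n.+1 @^-1` B) h.

Definition is_stationary (R : realType) d (T : measurableType d)
    (P : probability T R) (X : nat -> {RV P >-> R}) : Prop :=
  forall (n k : nat) (A : nat -> set R), (forall i, measurable (A i)) ->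
    P [set w | forall i, (i <= n)%N -> A i (X (k + i)%N w)] =
    P [set w | forall i, (i <= n)%N -> A i (X i w)].

Definition copula_chain (R : realType) (C : R -> R -> R) (F : R -> R)
    d (T : measurableType d) (P : probability T R) (X : nat -> {RV P >-> R})
    : Prop :=
  [/\ is_markov X, is_stationary X,
      forall n r, cdf (X n) r = (F r)%:E &
      forall n u v, u \in `[0, 1] -> v \in `[0, 1] ->
        P [set w | F (X n w) <= u /\ F (X n.+1 w) <= v] = (C u v)%:E].

(* The coefficients are extended reals, since psi_n may be infinite. *)

Section coefficients.
Context (R : realType) d (T : measurableType d) (P : probability T R).
Variable X : nat -> {RV P >-> R}.

Definition marg (A : set R) : R := fine (P (X 0%N @^-1` A)).

Definition joint (n : nat) (A B : set R) : R :=
  fine (P (X 0%N @^-1` A `&` X n @^-1` B)).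

Definition phi_coef (n : nat) : \bar R :=
  ereal_sup [set z | exists A B : set R,
    [/\ measurable A, measurable B, 0 < marg A * marg B &
        z = `|joint n A B / marg A - marg B|%:E]].

Definition psi_coef (n : nat) : \bar R :=
  ereal_sup [set z | exists A B : set R,
    [/\ measurable A, measurable B, 0 < marg A * marg B &
        z = (`|joint n A B - marg A * marg B| / (marg A * marg B))%:E]].

Definition psi'_coef (n : nat) : \bar R :=
  ereal_inf [set z | exists A B : set R,
    [/\ measurable A, measurable B, 0 < marg A * marg B &
        z = (joint n A B / (marg A * marg B))%:E]].

Definition rho_coef (n : nat) : \bar R :=
  ereal_sup [set z | exists f : R -> R,
    [/\ measurable_fun setT f,
        'E_P[fun w => (f (X 0%N w))%R]%E = 0%E,
        'E_P[fun w => (f (X 0%N w) ^+ 2)%R]%E = 1%E &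
        z = `|'E_P[fun w => (f (X 0%N w) * f (X n w))%R]|%E]].

(* k is a regular version of the conditional distribution P(X_n in . | X_0). *)
Definition is_regular_cond (n : nat) (k : R.-pker R ~> R) : Prop :=
  forall B : set R, measurable B ->
    is_cond_prob P (sigma_of X [set 0%N]) (X n @^-1` B)
      (fun w => k (X 0%N w) B).

(* The value b does not depend on the version k, as any two regular versions
   agree almost surely. *)
Definition is_beta_coef (n : nat) (b : \bar R) : Prop :=
  exists2 k : R.-pker R ~> R, is_regular_cond n k &
    (b = \int[P]_w ereal_sup
           [set `|k (X 0%N w) B - P (X 0%N @^-1` B)|
             | B in [set B : set R | measurable B]])%E.

Definition phi_mixing : Prop := phi_coef @ \oo --> (0 : \bar R).
Definition rho_mixing : Prop := rho_coef @ \oo --> (0 : \bar R).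
Definition psi_mixing : Prop := psi_coef @ \oo --> (0 : \bar R).
Definition psi'_mixing : Prop := psi'_coef @ \oo --> (1%:E : \bar R).
Definition beta_mixing : Prop :=
  exists2 b : nat -> \bar R, (forall n, is_beta_coef n (b n)) &
    b @ \oo --> (0 : \bar R).

End coefficients.

Definition chain_property (R : realType) : Type :=
  forall d (T : measurableType d) (P : probability T R),
    (nat -> {RV P >-> R}) -> Prop.

(* Every chain generated by C and a continuous marginal is mixing. *)
Definition generates (R : realType) (mixing : chain_property R)
    (C : R -> R -> R) : Prop :=
  forall F : R -> R, continuous F ->
  forall d (T : measurableType d) (P : probability T R)
    (X : nat -> {RV P >-> R}),
    copula_chain C F X -> mixing d T P X.

(* No chain generated by C and a continuous marginal is mixing (this is
   stronger than the negation of [generates], given that chains exist). *)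
Definition generates_no (R : realType) (mixing : chain_property R)
    (C : R -> R -> R) : Prop :=
  forall F : R -> R, continuous F ->
  forall d (T : measurableType d) (P : probability T R)
    (X : nat -> {RV P >-> R}),
    copula_chain C F X -> ~ mixing d T P X.

(* Main.v *)
Require Import Defs.
From HB Require Import structures.
From mathcomp Require Import all_boot all_order all_algebra.
From mathcomp Require Import all_classical all_reals all_analysis.
From mathcomp Require Import measurable_realfun.
From mathcomp Require Import ring lra.
Import Order.TTheory GRing.Theory Num.Theory.
Import numFieldNormedType.Exports.
Local Open Scope classical_set_scope.
Local Open Scope ring_scope.

Set Implicit Arguments.
Unset Strict Implicit.
Unset Printing Implicit Defensive.

(* Let H = {F > 1/2}, a set of marginal probability 1/2, and let m be the signed
   measure with density 1 on H and -1 off H with respect to the marginal P.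
   Integrating the density of the copula gives C(u, v) = u v + lambda t(u) t(v)
   with t(u) = |u - 1/2| - 1/2, which says that
     P(X_n in A, X_{n+1} in B) = P(A) P(B) + lambda m(A) m(B).
   Since m(H) = 1/2 and m(~H) = -1/2, the Markov property and induction yield
     P(X_0 in A, X_n in B) = P(A) P(B) + lambda^n m(A) m(B).
   As |m| <= P, every coefficient is within |lambda|^n of its independent value.
   When |lambda| = 1, the set H (and, for rho, the function sign(2 F - 1)) keeps
   every coefficient bounded away from that value. *)

(** A signed measure is awkward for uniqueness and Tonelli arguments. The product formula is
    therefore also read blockwise: relative to the product of the marginals, the joint law has
    density [1 + c] on the two diagonal blocks cut out by [H] and its complement, and [1 - c] on the
    two others. For [|c| <= 1] this is a positive combination of four product measures. The powers
    of lambda multiply without an extra constant because the function equal to 1 on H and -1 off H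
    integrates to 1 against m. The copula describes events F(X_n) <= u, whereas the coefficients
    need events on X_n itself. As F may be flat on intervals, the two kinds of events are matched
    only up to null sets. The Markov property provides an unspecified common version of two
    conditional probabilities; the induction needs only its integrals, and these agree with those of
    an explicit two-valued version. All formulas start at lag 1: at lag 0 the pair lies on the
    diagonal and has a different law, which does not affect limits. *)

(** * Lebesgue measure of the pieces of a rectangle cut at 1/2 *)

Section quadrant_masses.
Context {R : realType}.
Implicit Types (u v x : R) (A B : set R).

(** The primitive of sign(2x - 1) that vanishes at 0; that it also vanishes at 1 gives the copula
    its uniform marginals. *)
Definition tent u : R := `|u - 2^-1| - 2^-1.

Let leb := @lebesgue_measure R.

Lemma lebesgue2_setX A B : measurable A -> measurable B ->
  @lebesgue2 R (A `*` B) = (leb A * leb B)%E.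
Proof. by move=> mA mB; rewrite /lebesgue2 product_measure1E. Qed.

Lemma lebesgue_itv0 u : 0 <= u -> leb `[0, u]%classic = u%:E.
Proof.
move=> u0; rewrite /leb lebesgue_measure_itv /= lte_fin.
case: ltP => [_|u0']; first by rewrite oppr0 adde0.
by congr (_%:E); apply/eqP; rewrite eq_le u0 u0'.
Qed.

Lemma lebesgue_itv0I_gt u : 0 <= u ->
  leb (`]2^-1, +oo[%classic `&` `[0, u]%classic) = (Num.max 0 (u - 2^-1))%:E.
Proof.
move=> u0; rewrite (_ : _ `&` _ = `]2^-1, u]%classic); last first.
  apply/seteqP; split => x /=; rewrite !in_itv/= ?andbT.
    by case=> -> /andP[].
  move=> /andP[x2 xu]; split=> //; rewrite xu andbT.
  by rewrite (le_trans _ (ltW x2)).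
rewrite /leb lebesgue_measure_itv /= lte_fin; case: ltP => u2.
  by rewrite -EFinB; congr (_%:E); apply/esym/max_idPr; rewrite subr_ge0 ltW.
by congr (_%:E); apply/esym/max_idPl; rewrite subr_le0.
Qed.

Lemma lebesgue_itv0I_lt u : 0 <= u ->
  leb (`]-oo, 2^-1[%classic `&` `[0, u]%classic) = (Num.min u 2^-1)%:E.
Proof.
move=> u0; have [u2|u2] := ltP u 2^-1.
  rewrite (_ : _ `&` _ = `[0, u]%classic) ?lebesgue_itv0//.
  apply/seteqP; split => x /=; rewrite !in_itv/=; first by case.
  by move=> /andP[-> xu]; split=> //; exact: le_lt_trans u2.
rewrite (_ : _ `&` _ = `[0, 2^-1[%classic).
  by rewrite /leb lebesgue_measure_itv /= lte_fin invr_gt0 ltr0n oppr0 adde0.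
apply/seteqP; split => x /=; rewrite !in_itv/=.
  by move=> [-> /andP[->]].
by move=> /andP[-> x2]; split => //; rewrite (le_trans (ltW x2)).
Qed.

Lemma tentE u : Num.max 0 (u - 2^-1) - Num.min u 2^-1 = tent u.
Proof.
rewrite /tent; have [u2|u2] := leP u 2^-1.
- rewrite (max_idPl _) ?subr_le0// ler0_norm ?subr_le0//; lra.
- rewrite (max_idPr _) ?subr_ge0 ?ltW// gtr0_norm ?subr_gt0//; lra.
Qed.

End quadrant_masses.

(** * Closed form of the sign copula *)

Section sign_copula_formula.
Context {R : realType}.
Implicit Types (u v x lambda : R) (A B : set R).

(** Both intervals are open because the sign is 0 at 1/2. *)
Lemma sgr_indicE x : Num.sg (2 * x - 1) =
  \1_(`]2^-1, +oo[%classic : set R) x - \1_(`]-oo, 2^-1[%classic : set R) x.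
Proof.
rewrite !indicE !mem_setE !in_itv /= andbT.
have [x2|x2|<-] := ltgtP 2^-1 x.
- by rewrite gtr0_sg ?subr0// subr_gt0 -ltr_pdivrMl// mulr1.
- by rewrite ltr0_sg ?sub0r// subr_lt0 -ltr_pdivlMl// mulr1.
- by rewrite mulfV// !subrr sgr0.
Qed.

Lemma integrable_indic_rect u v A B : 0 <= u -> 0 <= v ->
  measurable A -> measurable B ->
  (@lebesgue2 R).-integrable (`[0, u]%classic `*` `[0, v]%classic)
    (EFin \o (\1_(A `*` B) : R * R -> R)).
Proof.
move=> u0 v0 mA mB.
apply: measurable_bounded_integrable => //=.
- exact: measurableX.
- by rewrite [ltLHS]lebesgue2_setX// !lebesgue_itv0// -EFinM ltry.
- by apply: measurable_indic; exact: measurableX.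
- exists 1; split => // M M1 z _ /=; rewrite indicE normr_nat.
  by rewrite (le_trans _ (ltW M1))//; case: (_ \in _).
Qed.

Lemma Rintegral_indic_rect u v A B a b : 0 <= u -> 0 <= v ->
  measurable A -> measurable B ->
  (@lebesgue_measure R) (A `&` `[0, u]%classic) = a%:E ->
  (@lebesgue_measure R) (B `&` `[0, v]%classic) = b%:E ->
  \int[@lebesgue2 R]_(z in `[0, u]%classic `*` `[0, v]%classic)
    (\1_(A `*` B) z) = a * b :> R.
Proof.
move=> u0 v0 mA mB ua vb; rewrite /Rintegral integral_indic//=; last 2 first.
- exact: measurableX.
- exact: measurableX.
rewrite -setXI [X in fine X]lebesgue2_setX ?ua ?vb//; exact: measurableI.
Qed.

Let I b : set R := if b then `]2^-1, +oo[%classic else `]-oo, 2^-1[%classic.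

Let mI b : measurable (I b). Proof. by case: b; exact: measurable_itv. Qed.

(** Expanding the product of signs over the four quadrants reduces integration of the density to
    measuring rectangles. *)
Lemma sign_densityE lambda (z : R * R) : sign_density lambda z =
  1 + lambda * ((\1_(I true `*` I true) z + \1_(I false `*` I false) z) -
                (\1_(I true `*` I false) z + \1_(I false `*` I true) z)).
Proof.
have iX (A B : set R) : \1_(A `*` B) z = \1_A z.1 * \1_B z.2 :> R.
  by rewrite !indicE in_setX -natrM mulnb.
rewrite !iX /sign_density !sgr_indicE /=; ring.
Qed.

Lemma measurable_sign_density lambda (D : set (R * R)) :
  measurable D -> measurable_fun D (sign_density lambda).
Proof.
move=> mD; apply: (eq_measurable_fun _ (fun z _ => esym (sign_densityE lambda z))).
have m1 b c : measurable_fun D (\1_(I b `*` I c) : R * R -> R).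
  by apply: measurable_indic; exact: measurableX.
apply: measurable_funD => //; apply: measurable_funM => //.
by apply: measurable_funB; exact: measurable_funD.
Qed.

Lemma Rintegral_sign_density lambda u v : 0 <= u -> 0 <= v ->
  let D := `[0, u]%classic `*` `[0, v]%classic in
  (@lebesgue2 R).-integrable D
    (EFin \o (sign_density lambda : R * R -> R)) /\
  \int[@lebesgue2 R]_(z in D) sign_density lambda z =
    u * v + lambda * (tent u * tent v) :> R.
Proof.
move=> u0 v0 D.
have mD : measurable (D : set (measurableTypeR R * measurableTypeR R)%type).
  by apply: measurableX; exact: measurable_itv.
have intI b c := integrable_indic_rect u0 v0 (mI b) (mI c).
have int1 : (@lebesgue2 R).-integrable D (EFin \o (cst 1 : R * R -> R)).
  rewrite (_ : cst 1 = (\1_(setT `*` setT) : R * R -> R)).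
    exact: integrable_indic_rect.
  by rewrite setXTT indicT.
(* Integrability is restated with real-valued combinations under [EFin], the form that the rules for
   [Rintegral] expect when they are nested. *)
have intD f g : (@lebesgue2 R).-integrable D (EFin \o f) ->
    (@lebesgue2 R).-integrable D (EFin \o g) ->
    (@lebesgue2 R).-integrable D (EFin \o (fun z => f z + g z)).
  by move=> f1 g1; exact: (integrableD mD f1 g1).
have intB f g : (@lebesgue2 R).-integrable D (EFin \o f) ->
    (@lebesgue2 R).-integrable D (EFin \o g) ->
    (@lebesgue2 R).-integrable D (EFin \o (fun z => f z - g z)).
  by move=> f1 g1; exact: (integrableB mD f1 g1).
have intZ f : (@lebesgue2 R).-integrable D (EFin \o f) ->
    (@lebesgue2 R).-integrable D (EFin \o (fun z => lambda * f z)).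
  by move=> f1; exact: (integrableZl mD lambda f1).
have intS := intD _ _ (intI true true) (intI false false).
have intM := intD _ _ (intI true false) (intI false true).
have intX := intB _ _ intS intM.
have Du c := Rintegral_indic_rect u0 v0 (mI true) (mI c) (lebesgue_itv0I_gt u0).
have Dl c := Rintegral_indic_rect u0 v0 (mI false) (mI c) (lebesgue_itv0I_lt u0).
split.
  rewrite (_ : EFin \o _ = EFin \o (fun z => 1 + lambda *
      ((\1_(I true `*` I true) z + \1_(I false `*` I false) z) -
       (\1_(I true `*` I false) z + \1_(I false `*` I true) z)))).
    exact: (intD _ _ int1 (intZ _ intX)).
  by apply/funext => z /=; rewrite sign_densityE.
under eq_Rintegral do rewrite sign_densityE.
rewrite (RintegralD mD int1 (intZ _ intX)) (RintegralZl _ mD intX).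
rewrite (RintegralB mD intS intM) !(RintegralD mD (intI _ _) (intI _ _)).
rewrite (Du _ true (lebesgue_itv0I_gt v0)) (Du _ false (lebesgue_itv0I_lt v0)).
rewrite (Dl _ true (lebesgue_itv0I_gt v0)) (Dl _ false (lebesgue_itv0I_lt v0)).
have -> : \int[@lebesgue2 R]_(z in D) (1 : R) = u * v.
  have := @Rintegral_indic_rect u v setT setT u v u0 v0 measurableT measurableT.
  by rewrite setXTT indicT !setTI => -> //; rewrite lebesgue_itv0.
rewrite -!tentE; ring.
Qed.

Lemma sign_copulaE lambda u v : 0 <= u -> 0 <= v ->
  sign_copula lambda u v = u * v + lambda * (tent u * tent v).
Proof. by move=> u0 v0; have [] := Rintegral_sign_density lambda u0 v0. Qed.

End sign_copula_formula.

(** * Copula axioms, densities and the failure of a lower bound *)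

Section sign_copula_facts.
Context {R : realType}.
Implicit Types (u v x lambda : R).

Lemma tent_le_dist u v : u <= v -> `|tent v - tent u| <= v - u.
Proof.
move=> uv; rewrite -[leRHS]ger0_norm ?subr_ge0//.
rewrite (_ : tent v - tent u = `|v - 2^-1| - `|u - 2^-1|); last first.
  by rewrite /tent; ring.
rewrite (le_trans (ler_dist_dist _ _))// le_eqVlt; apply/orP; left; apply/eqP.
by congr `|_|; ring.
Qed.

Lemma tent0 : tent 0 = 0 :> R.
Proof. by rewrite /tent sub0r normrN ger0_norm ?invr_ge0// subrr. Qed.

Lemma tent1 : tent 1 = 0 :> R.
Proof. by rewrite /tent ger0_norm; lra. Qed.

Lemma tent_half : tent 2^-1 = - 2^-1 :> R.
Proof. by rewrite /tent subrr normr0 sub0r. Qed.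

Lemma is_copula_sign_copula lambda : `|lambda| <= 1 ->
  is_copula (sign_copula lambda).
Proof.
move=> l1; split=> [u|u|u u' v v' u0 uu' u'1 v0 vv' v'1].
- rewrite in_itv/= => /andP[u0 u1]; rewrite !sign_copulaE// tent0.
  by rewrite !(mulr0, mul0r, addr0).
- rewrite in_itv/= => /andP[u0 u1]; rewrite !sign_copulaE// tent1.
  by rewrite !(mulr0, mul0r, addr0, mulr1, mul1r).
have u'0 := le_trans u0 uu'; have v'0 := le_trans v0 vv'.
rewrite !sign_copulaE//.
(* The mass of a rectangle is its area plus [lambda] times two increments of [tent]. Each increment
   is at most the corresponding side, so the correction never exceeds the area. *)
rewrite [leRHS](_ : _ = (u' - u) * (v' - v) +
  lambda * ((tent u' - tent u) * (tent v' - tent v))); last by ring.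
rewrite -lerBlDr sub0r (le_trans (ler_norm _))// normrN !normrM.
rewrite -[leRHS]mul1r ler_pM// ?mulr_ge0//.
by rewrite ler_pM// tent_le_dist.
Qed.

Lemma sign_density_ge0 lambda (z : R * R) : `|lambda| <= 1 ->
  0 <= sign_density lambda z.
Proof.
move=> l1; rewrite /sign_density -lerBlDl sub0r.
suff : `|lambda * Num.sg (2 * z.1 - 1) * Num.sg (2 * z.2 - 1)| <= 1.
  by rewrite ler_norml => /andP[].
by rewrite !normrM !normr_sg !mulr_ile1// lern1 leq_b1.
Qed.

Lemma has_density_sign_copula lambda : `|lambda| <= 1 ->
  has_density (sign_copula lambda) (sign_density lambda).
Proof.
move=> l1; split=> [|z _|u v].
- by apply: measurable_sign_density; exact: measurableX.
- exact: sign_density_ge0.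
rewrite !in_itv/= => /andP[u0 u1] /andP[v0 v1].
have [intd _] := Rintegral_sign_density lambda u0 v0.
rewrite /sign_copula /Rintegral fineK//; apply: integrable_fin_num intd.
by apply: measurableX; exact: measurable_itv.
Qed.

Lemma sign_copula_mix lambda u v : 0 <= u -> 0 <= v ->
  sign_copula lambda u v =
    (1 + lambda) / 2 * sign_copula 1 u v +
    (1 - lambda) / 2 * sign_copula (-1) u v.
Proof. by move=> u0 v0; rewrite !sign_copulaE//; field. Qed.

Let RR := (measurableTypeR R * measurableTypeR R)%type.

Lemma lebesgue2_unit_square : @lebesgue2 R (@unit_square R) = 1%E.
Proof.
have m01 : measurable (`[0, 1]%classic : set R) by exact: measurable_itv.
by rewrite /unit_square lebesgue2_setX// lebesgue_itv0// mule1.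
Qed.

(* The rectangle [0, u] x ]v, v'] carries no mass of C, so it cannot meet a set
   of full measure on which the density is at least eps. *)
Lemma not_density_bounded_away (C : R -> R -> R) (u v v' : R) :
  0 < u -> u <= 1 -> 0 <= v -> v < v' -> v' <= 1 ->
  C u v = C u v' -> ~ has_density_bounded_away_from_0 C.
Proof.
move=> u0 u1 v0 vv' v'1 CE [c [[mc c0 Cc] [eps [S [eps0 mS SU S1 Sc]]]]].
pose Q : set RR := `[0, u]%classic `*` `]v, v']%classic.
pose D : set RR := `[0, u]%classic `*` `[0, v]%classic.
have mQ : measurable Q by apply: measurableX; exact: measurable_itv.
have mD : measurable D by apply: measurableX; exact: measurable_itv.
have {}mS : measurable (S : set RR) by exact: mS.
have mU : measurable (@unit_square R : set RR).
  by apply: measurableX; exact: measurable_itv.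
have {}mc : measurable_fun (@unit_square R : set RR) c by exact: mc.
have QU : Q `<=` @unit_square R.
  move=> [x y] [/=]; rewrite !in_itv/= => /andP[x0 xu] /andP[vy yv'].
  rewrite /unit_square; split; rewrite /= in_itv/=.
    by rewrite x0 (le_trans xu).
  by rewrite (le_trans v0 (ltW vy)) (le_trans yv').
have DU : D `<=` @unit_square R.
  move=> [x y] [/=]; rewrite !in_itv/= => /andP[x0 xu] /andP[y0 yv].
  rewrite /unit_square; split; rewrite /= in_itv/=.
    by rewrite x0 (le_trans xu).
  by rewrite y0 (le_trans yv)// (le_trans (ltW vv')).
have DQ : `[0, u]%classic `*` `[0, v']%classic = D `|` Q.
  apply/seteqP; split => -[x y]; rewrite /D /Q /= !in_itv/=.
    by move=> [-> /andP[-> yv']]; case: (leP y v) => yv; [left|right].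
  by move=> [[-> /andP[-> yv]]|[-> /andP[vy ->]]]; split => //;
    [exact: (le_trans yv (ltW vv'))|rewrite (le_trans v0 (ltW vy))].
have disj : [disjoint D & Q].
  apply/disj_set2P; rewrite -subset0 => -[x y] [[/= _]].
  by rewrite !in_itv/= => /andP[_ yv] [_ /andP[/lt_geF]]; rewrite yv.
have Q0 : (\int[@lebesgue2 R]_(z in Q) (c z)%:E = 0)%E.
  have u01 : u \in `[0, 1] by rewrite in_itv/= ltW.
  have v01 : v \in `[0, 1] by rewrite in_itv/= v0 (le_trans (ltW vv')).
  have v'01 : v' \in `[0, 1] by rewrite in_itv/= (le_trans v0 (ltW vv')).
  have := Cc u v' u01 v'01; rewrite DQ ge0_integral_setU//=; last 2 first.
  - apply/measurable_EFinP; apply: measurable_funS mc => //.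
    by move=> z [/DU|/QU].
  - by move=> z [/DU|/QU] Uz; rewrite lee_fin c0.
  rewrite -(Cc u v u01 v01) -CE => /(congr1 (fun t => t - (C u v)%:E)%E).
  by rewrite addeAC subee// add0e => <-.
pose mu : {measure set RR -> \bar R} :=
  (@lebesgue_measure R \x @lebesgue_measure R)%E.
have SQ : (u * (v' - v))%:E = mu (Q `&` S).
  have QE : mu Q = (u * (v' - v))%:E.
    rewrite [LHS]lebesgue2_setX//; try exact: measurable_itv.
    by rewrite lebesgue_itv0 ?ltW// lebesgue_measure_itv/= lte_fin vv' -EFinB -EFinM.
  (* [S] fills the square up to a null set, so [Q] keeps its whole area when cut down to [S]. *)
  have US : mu (@unit_square R `\` S) = 0%E.
    have U1 : mu (@unit_square R) = 1%E by exact: lebesgue2_unit_square.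
    have {}S1 : mu S = 1%E by exact: S1.
    have UI : @unit_square R `&` S = S by exact: setIidr.
    by rewrite measureD//= ?UI ?U1 ?S1 ?ltry// subee.
  have Q'0 : mu (Q `\` S) = 0%E.
    apply: subset_measure0 US; [exact: measurableD..|].
    by move=> z [/QU Uz Sz].
  rewrite -QE -{1}(setUIDK Q S) measureU/=; first by rewrite Q'0 adde0.
  - exact: measurableI.
  - exact: measurableD.
  - by rewrite setDE setIACA setICr setI0.
have : (0 < (eps * (u * (v' - v)))%:E)%E.
  by rewrite lte_fin !mulr_gt0// subr_gt0.
rewrite ltNge => /negP; apply.
rewrite -Q0 EFinM SQ -(integral_cst mu); last exact: measurableI.
have mcQ : measurable_fun Q (EFin \o c).
  by apply/measurable_EFinP; exact: measurable_funS mc.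
apply: (@le_trans _ _ (\int[mu]_(z in Q `&` S) (c z)%:E)%E).
  apply: ge0_le_integral => //=.
  - exact: measurableI.
  - by move=> *; rewrite lee_fin ltW.
  - apply: measurable_funS mcQ => //.
  - by move=> z [_ Sz]; rewrite lee_fin Sc.
apply: ge0_subset_integral => //; first exact: measurableI.
by move=> z /QU Uz; rewrite lee_fin c0.
Qed.

(** For lambda = 1 the off-diagonal quadrant [0, 1/2] x ]1/2, 1] carries no mass. *)
Lemma sign_copula1_not_density :
  ~ has_density_bounded_away_from_0 (@sign_copula R 1).
Proof.
apply: (@not_density_bounded_away _ 2^-1 2^-1 1); try lra.
rewrite !sign_copulaE ?tent1 ?tent_half; lra.
Qed.

(** For lambda = -1 the massless rectangle lies in the lower diagonal quadrant. *)
Lemma sign_copulaN1_not_density :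
  ~ has_density_bounded_away_from_0 (@sign_copula R (-1)).
Proof.
apply: (@not_density_bounded_away _ 2^-1 0 2^-1); try lra.
rewrite !sign_copulaE ?tent0 ?tent_half; lra.
Qed.

End sign_copula_facts.

(** * The signed mass and mixtures over the two halves *)

Section half_mix.
Context {R : realType} (mu : probability R R) (H : set R).
Hypothesis mH : measurable H.
Implicit Types (A B : set R) (c : R).

Definition smass A : R := fine (mu (A `&` H)) - fine (mu (A `&` ~` H)).

(** The coefficient [c] is left free so that it can become [lambda ^+ n.+1] along the induction. *)
Definition dep c A B : R := fine (mu A) * fine (mu B) + c * (smass A * smass B).

Lemma fine_splitE A : measurable A ->
  fine (mu A) = fine (mu (A `&` H)) + fine (mu (A `&` ~` H)).
Proof.
move=> mA; have mAH := measurableI _ _ mA mH.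
have mAC := measurableI _ _ mA (measurableC mH).
rewrite -fineD ?fin_num_measure// -measureU//= ?setUIDK//.
by rewrite setIACA setICr setI0.
Qed.

(** For fixed [B] and [|c| <= 1] this form shows a nonnegative combination of two measures in [A],
    which makes uniqueness of measures applicable. *)
Lemma depE c A B : measurable A -> measurable B -> dep c A B =
  ((1 + c) * fine (mu (B `&` H)) + (1 - c) * fine (mu (B `&` ~` H))) *
    fine (mu (A `&` H)) +
  ((1 - c) * fine (mu (B `&` H)) + (1 + c) * fine (mu (B `&` ~` H))) *
    fine (mu (A `&` ~` H)).
Proof. by move=> mA mB; rewrite /dep /smass (fine_splitE mA) (fine_splitE mB); ring. Qed.

Lemma dep_sym c A B : dep c A B = dep c B A.
Proof. by rewrite /dep; ring. Qed.

Lemma smass_le A : measurable A -> `|smass A| <= fine (mu A).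
Proof.
move=> mA; rewrite fine_splitE// /smass (le_trans (ler_normB _ _))//.
by rewrite !ger0_norm ?fine_ge0.
Qed.

Definition half_mix (a b : {nonneg R}) : {measure set R -> \bar R} :=
  measure_add (mscale a (mrestr mu mH)) (mscale b (mrestr mu (measurableC mH))).

Lemma half_mixE a b A : measurable A -> half_mix a b A =
  (a%:num * fine (mu (A `&` H)) + b%:num * fine (mu (A `&` ~` H)))%:E.
Proof.
move=> mA; rewrite [LHS]measure_addE /= /mscale /mrestr EFinD !EFinM.
have mAH := measurableI _ _ mA mH.
have mAC := measurableI _ _ mA (measurableC mH).
by rewrite !fineK// fin_num_measure.
Qed.

End half_mix.

(** * Measures determined by left rays *)

Section rays.
Context {R : realType}.

Lemma measurable_rays : (measurable : set (set R)) =
  <<s [set A : set R | exists x, A = `]-oo, x]%classic] >>.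
Proof.
have := RGenOInfty.measurableE R => E; rewrite [LHS]E.
apply/seteqP; split; apply: smallest_sub; try exact: smallest_sigma_algebra.
- move=> _ [x ->]; rewrite -setCitvl; apply: sigma_algebraC.
  by apply: sub_sigma_algebra; exists x.
- by move=> _ [x ->]; rewrite -E; exact: measurable_itv.
Qed.

(** The rays are closed under intersection, by taking the minimum of the endpoints, and those ending
    at natural numbers exhaust the line. *)
Lemma measure_rays_unique (m1 m2 : {measure set R -> \bar R}) :
  (forall a, m1 `]-oo, a]%classic = m2 `]-oo, a]%classic) ->
  (forall a, (m1 `]-oo, a]%classic < +oo)%E) ->
  forall A, measurable A -> m1 A = m2 A.
Proof.
move=> m12 m1oo.
apply: (measure_unique [set A : set R | exists x, A = `]-oo, x]%classic]
  (fun n => `]-oo, n%:R]%classic)).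
- exact: measurable_rays.
- move=> _ _ [x ->] [y ->]; exists (Num.min x y).
  by apply/seteqP; split => z /=; rewrite !in_itv/= le_min;
    [case=> -> ->|move=> /andP[]].
- by move=> n; exists n%:R.
- apply/seteqP; split => // x _; exists (Num.truncn `|x|).+1 => //=.
  by rewrite in_itv/= (le_trans (ler_norm _))// ltW// truncnS_gt.
- by move=> _ [x ->]; exact: m12.
- by move=> k; exact: m1oo.
Qed.

End rays.

(** * Integrals of two-valued functions *)

Section two_valued.
Context {R : realType} d (T : measurableType d) (P : probability T R).

Lemma measurable_two_valued (V : set T) (a b : R) : measurable V ->
  measurable_fun setT (fun w => if w \in V then a else b).
Proof.
move=> mV; apply: measurable_fun_if => //.
apply: (measurable_fun_bool true); rewrite setTI.
by rewrite (_ : _ @^-1` _ = V)//; apply/seteqP; split=> w /=;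
  [exact: set_mem|exact: mem_set].
Qed.

Lemma integrable_two_valued (V : set T) (a b : R) : measurable V ->
  P.-integrable setT (fun w => (if w \in V then a else b)%:E).
Proof.
move=> mV; apply: measurable_bounded_integrable => //.
- by rewrite [ltLHS]probability_setT ltry.
- exact: measurable_two_valued.
exists (Num.max `|a| `|b|); split; first exact: num_real.
move=> M abM w _ /=; rewrite (le_trans _ (ltW abM))// le_max.
by case: ifP; rewrite lexx// orbT.
Qed.

Lemma integral_two_valued (D V : set T) (a b : R) :
  measurable D -> measurable V ->
  (\int[P]_(w in D) (if w \in V then a else b)%:E =
   (a * fine (P (D `&` V)) + b * fine (P (D `&` ~` V)))%:E)%E.
Proof.
move=> mD mV; have mDV := measurableI _ _ mD mV.
have mDC := measurableI _ _ mD (measurableC mV).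
rewrite -{1}(setUIDK D V) setDE integral_setU//; last 2 first.
- apply: measurable_funTS; exact: measurable_int (integrable_two_valued a b mV).
- by apply/disj_set2P; rewrite setIACA setICr setI0.
rewrite (eq_integral (cst a%:E)); last first.
  by move=> w; rewrite inE => -[_ Vw]; rewrite mem_set.
rewrite [X in (_ + X)%E](eq_integral (cst b%:E)); last first.
  by move=> w; rewrite inE => -[_ Vw]; rewrite memNset.
by rewrite !integral_cst// EFinD !EFinM !fineK// fin_num_measure.
Qed.

End two_valued.

(** * Uniqueness of conditional probabilities *)

Section cond_prob.
Context {R : realType} d (T : measurableType d) (P : probability T R).

(** The set where one version exceeds the other lies in the sub-sigma-algebra and the excess
    integrates to 0 over it, so it is null. [D] ranges over all measurable sets because the lemma is
    applied to an event of [X 0], which need not be generated by the later variable that is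
    conditioned on. *)
Lemma cond_prob_unique (G : set (set T)) (E : set T) (h g : T -> \bar R) :
  G `<=` measurable -> measurable E ->
  is_cond_prob P <<s G >> E h -> is_cond_prob P <<s G >> E g ->
  forall D, measurable D -> (\int[P]_(w in D) h w = \int[P]_(w in D) g w)%E.
Proof.
move=> Gm mE [mh ih hE] [mg ig gE] D mD.
have sGm : <<s G >> `<=` measurable.
  by apply: smallest_sub => //; exact: sigma_algebra_measurable.
have null f1 f2 : (forall B : set (\bar R), measurable B -> <<s G >> (f1 @^-1` B)) ->
    (forall B : set (\bar R), measurable B -> <<s G >> (f2 @^-1` B)) ->
    P.-integrable setT f1 -> P.-integrable setT f2 ->
    (forall D, <<s G >> D -> (\int[P]_(w in D) f1 w = P (D `&` E))%E) ->
    (forall D, <<s G >> D -> (\int[P]_(w in D) f2 w = P (D `&` E))%E) ->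
    P [set w | f1 w < f2 w]%E = 0%E.
  move=> m1 m2 i1 i2 e1 e2; set N := [set w | _].
  (* [e1] and [e2] speak only of sets in the generated sigma-algebra, so [f1] and [f2] are compared
     as functions measurable for that structure. *)
  have GN : <<s G >> N.
    pose T' := g_sigma_algebraType G.
    have mm1 : measurable_fun (setT : set T') (f1 : T' -> \bar R).
      by move=> _ B mB; rewrite setTI; exact: m1.
    have mm2 : measurable_fun (setT : set T') (f2 : T' -> \bar R).
      by move=> _ B mB; rewrite setTI; exact: m2.
    have := measurable_lte (@measurableT _ T') mm1 mm2.
    by rewrite setTI.
  have mN := sGm _ GN.
  have i1N : P.-integrable N f1 by apply: integrableS i1.
  have i2N : P.-integrable N f2 by apply: integrableS i2.
  have : (\int[P]_(w in N) `|f2 w - f1 w| = 0)%E.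
    rewrite (eq_integral (fun w => f2 w - f1 w)%E); last first.
      by move=> w; rewrite inE => wN; rewrite gee0_abs// ltW// sube_gt0.
    rewrite integralB// e1// e2// subee// fin_num_measure//.
    exact: measurableI.
  move/(ae_eq_integral_abs _ mN); have mf : measurable_fun N (f2 \- f1)%E.
    exact: measurable_int (integrableB mN i2N i1N).
  move=> /(_ mf) /= [Z [mZ Z0 NZ]].
  apply: subset_measure0 Z0 => // w wN; apply: NZ => /= /(_ wN) f20.
  by move: wN; rewrite /N/= -sube_gt0 f20 ltxx.
have hg := null _ _ mh mg ih ig hE gE.
have gh := null _ _ mg mh ig ih gE hE.
have mhg : measurable [set w | h w < g w]%E.
  rewrite -[X in measurable X]setTI; apply: measurable_lte => //.
  - exact: measurable_int ih.
  - exact: measurable_int ig.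
have mgh : measurable [set w | g w < h w]%E.
  rewrite -[X in measurable X]setTI; apply: measurable_lte => //.
  - exact: measurable_int ig.
  - exact: measurable_int ih.
apply: ae_eq_integral => //.
- by apply: measurable_funTS; exact: measurable_int ih.
- by apply: measurable_funTS; exact: measurable_int ig.
exists ([set w | h w < g w]%E `|` [set w | g w < h w]%E); split.
- exact: measurableU.
- by rewrite measureU0.
- move=> w /= /not_implyP[_ /eqP]; rewrite neq_lt => /orP[]; by [left|right].
Qed.

End cond_prob.

(** * From rays to Borel sets in the joint formula *)

Section joint_extension.
Context {R : realType} d (T : measurableType d) (P : probability T R).
Variables (mu : probability R R) (H : set R).
Hypothesis mH : measurable H.

(** With [E] fixed, the left side is the image under [Y] of [P] restricted to [E]; both sides are
    finite measures in [A] that agree on rays. *)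
Lemma half_mix_ext (Y : {RV P >-> R}) (E : set T) (a b : R) :
  measurable E -> 0 <= a -> 0 <= b ->
  (forall x, P (Y @^-1` `]-oo, x]%classic `&` E) =
     (a * fine (mu (`]-oo, x]%classic `&` H)) +
      b * fine (mu (`]-oo, x]%classic `&` ~` H)))%:E) ->
  forall A, measurable A -> P (Y @^-1` A `&` E) =
     (a * fine (mu (A `&` H)) + b * fine (mu (A `&` ~` H)))%:E.
Proof.
move=> mE a0 b0 PY A mA.
have mY : measurable_fun setT (Y : T -> R) by [].
pose m1 : {measure set R -> \bar R} := pushforward (mrestr P mE) (Y : T -> R).
pose m2 := half_mix mu mH (NngNum a0) (NngNum b0).
have m2E B : measurable B -> m2 B = (a * fine (mu (B `&` H)) + b * fine (mu (B `&` ~` H)))%:E.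
  exact: half_mixE.
have -> : P (Y @^-1` A `&` E) = m1 mY A by [].
rewrite (measure_rays_unique (m1 := m1 mY) (m2 := m2)) ?m2E// => x.
- by rewrite m2E//; exact: PY.
- by rewrite /m1 /= /pushforward /mrestr PY ltry.
Qed.

Definition joint_dep (c : R) (Y Z : {RV P >-> R}) := forall A B,
  measurable A -> measurable B ->
  P (Y @^-1` A `&` Z @^-1` B) = (dep mu H c A B)%:E.

(** One variable is extended at a time: [A] while [B] is still a ray, then [B] for arbitrary [A], by
    the symmetry of [dep]. *)
Lemma joint_dep_ext c (Y Z : {RV P >-> R}) : `|c| <= 1 ->
  (forall x y, P (Y @^-1` `]-oo, x]%classic `&` Z @^-1` `]-oo, y]%classic) =
     (dep mu H c `]-oo, x]%classic `]-oo, y]%classic)%:E) ->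
  joint_dep c Y Z.
Proof.
rewrite ler_norml => /andP[cN1 c1] YZ.
have half (B : set R) : measurable B -> [/\
    0 <= (1 + c) * fine (mu (B `&` H)) + (1 - c) * fine (mu (B `&` ~` H)) &
    0 <= (1 - c) * fine (mu (B `&` H)) + (1 + c) * fine (mu (B `&` ~` H)) ].
  move=> mB; split; apply: addr_ge0; apply: mulr_ge0;
    rewrite ?fine_ge0//; lra.
have row y A : measurable A -> P (Y @^-1` A `&` Z @^-1` `]-oo, y]%classic) =
    (dep mu H c A `]-oo, y]%classic)%:E.
  move=> mA; have my : measurable (`]-oo, y]%classic : set R) by exact: measurable_itv.
  rewrite depE//; have [h1 h2] := half _ my; apply: half_mix_ext => //.
    exact: (measurable_funPTI Z my).
  by move=> x; rewrite YZ depE//; exact: measurable_itv.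
move=> A B mA mB; rewrite setIC dep_sym depE//.
have [h1 h2] := half _ mA; apply: half_mix_ext => //.
  exact: (measurable_funPTI Y mA).
by move=> y; rewrite setIC row// dep_sym depE//; exact: measurable_itv.
Qed.

End joint_extension.

(** * The one-step law of the chain *)

Section chain_law.
Context {R : realType} (lambda : R) (F : R -> R).
Context d (T : measurableType d) (P : probability T R).
Variable X : nat -> {RV P >-> R}.
Hypothesis lambda1 : `|lambda| <= 1.
Hypothesis chainX : copula_chain (sign_copula lambda) F X.

(** With a strict inequality the complement is the event F <= 1/2, whose probability can be read off
    the copula. *)
Definition upper_half : set R := [set x | 2^-1 < F x].

Let H := upper_half.
Let mu : probability R R := distribution P (X 0).

Let mray n a : measurable (X n @^-1` `]-oo, a]%classic).
Proof. exact: (measurable_funPTI (X n) (measurable_itv `]-oo, a])). Qed.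

Lemma chain_le n a : P (X n @^-1` `]-oo, a]%classic) = (F a)%:E.
Proof. by have [_ _ cdfX _] := chainX; rewrite -(cdfX n). Qed.

Lemma chain_cdf01 a : 0 <= F a <= 1.
Proof. by rewrite -!lee_fin -(chain_le 0) measure_ge0 probability_le1. Qed.

Lemma chain_cdf_homo : {homo F : x y / x <= y}.
Proof.
move=> x y xy; rewrite -lee_fin -!(chain_le 0) le_measure ?inE//.
by move=> w /=; rewrite !in_itv/= => /le_trans; exact.
Qed.

Lemma chain_cdf_measurable : measurable_fun setT F.
Proof. exact: nondecreasing_measurable chain_cdf_homo. Qed.

Lemma measurable_upper_half : measurable H.
Proof.
rewrite (_ : H = F @^-1` `]2^-1, +oo[%classic).
  rewrite -[X in measurable X]setTI; exact: chain_cdf_measurable.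
by apply/seteqP; split=> x /=; rewrite /H /upper_half /= in_itv/= andbT.
Qed.

Let mH := measurable_upper_half.

Lemma measurable_cdf_le n u : measurable [set w | F (X n w) <= u].
Proof.
rewrite (_ : [set _ | _] = X n @^-1` (F @^-1` `]-oo, u]%classic)).
  apply: measurable_funPTI; rewrite -[X in measurable X]setTI.
  exact: chain_cdf_measurable.
by apply/seteqP; split=> w /=; rewrite in_itv/=.
Qed.

(** This is the copula identity at [v = 1]: the second constraint becomes void and [tent1] removes
    the lambda term. *)
Lemma chain_cdf_le n u : 0 <= u <= 1 -> P [set w | F (X n w) <= u] = u%:E.
Proof.
move=> u01; have [_ _ _ XC] := chainX.
have := XC n u 1; rewrite !in_itv/= u01 lexx ler01 => /(_ isT isT).
have /andP[u0 u1] := u01.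
rewrite sign_copulaE// tent1 !mulr0 addr0 mulr1 => <-.
congr (P _); apply/seteqP; split=> w /=; last by case.
by split=> //; have /andP[] := chain_cdf01 (X n.+1 w).
Qed.

Lemma setI_same_measure (A A' B B' : set T) :
  measurable A -> measurable A' -> measurable B -> measurable B' ->
  A `<=` A' -> B `<=` B' -> P A = P A' -> P B = P B' ->
  P (A `&` B) = P (A' `&` B').
Proof.
move=> mA mA' mB mB' AA' BB' PA PB.
have diff0 C C' : measurable C -> measurable C' -> C `<=` C' -> P C = P C' ->
    P (C' `\` C) = 0%E.
  move=> mC mC' CC' PC; rewrite measureD//= ?(setIidr CC') ?PC ?subee//;
    by rewrite ?fin_num_measure// -ge0_fin_numE// fin_num_measure.
apply/eqP; rewrite eq_le; apply/andP; split.
  by rewrite le_measure ?inE//; [exact: measurableI..|exact: setISS].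
have mDA := measurableD mA' mA; have mDB := measurableD mB' mB.
have mD := measurableU _ _ mDA mDB; have mAB := measurableI _ _ mA mB.
rewrite (@le_trans _ _ (P ((A `&` B) `|` ((A' `\` A) `|` (B' `\` B)))))//.
  rewrite le_measure ?inE//; [exact: measurableI|exact: measurableU|].
  move=> w [A'w B'w]; have [Aw|Aw] := pselect (A w); last by right; left.
  by have [Bw|Bw] := pselect (B w); [left|right; right].
have PDA := diff0 _ _ mA mA' AA' PA; have PDB := diff0 _ _ mB mB' BB' PB.
by rewrite measureU0// measureU0.
Qed.

(** [X n <= a] implies [F (X n) <= F a], but the converse may fail where [F] is flat. Both events
    have probability [F a], so they differ by a null set. *)
Lemma chain_pair_le n a b :
  P (X n @^-1` `]-oo, a]%classic `&` X n.+1 @^-1` `]-oo, b]%classic) =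
  (sign_copula lambda (F a) (F b))%:E.
Proof.
have [_ _ _ XC] := chainX.
rewrite -(XC n); try by rewrite in_itv/= chain_cdf01.
apply: setI_same_measure => //.
- exact: measurable_cdf_le.
- exact: measurable_cdf_le.
- by move=> w /=; rewrite in_itv/=; exact: chain_cdf_homo.
- by move=> w /=; rewrite in_itv/=; exact: chain_cdf_homo.
- by rewrite chain_le chain_cdf_le// chain_cdf01.
- by rewrite chain_le chain_cdf_le// chain_cdf01.
Qed.

Lemma chain_same_law n A : measurable A -> P (X n @^-1` A) = mu A.
Proof.
move=> mA; apply: (measure_rays_unique
  (m1 := distribution P (X n)) (m2 := mu)) mA => a.
- by rewrite /mu /= /distribution /pushforward !chain_le.
- by rewrite /= /distribution /pushforward chain_le ltry.
Qed.

Lemma mu_ray a : mu `]-oo, a]%classic = (F a)%:E.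
Proof. exact: chain_le. Qed.

Lemma mu_lower_half : mu (~` H) = 2^-1%:E.
Proof.
rewrite -(chain_cdf_le 0); last by lra.
congr (P _); apply/seteqP; split=> w /=; rewrite /H /upper_half /= leNgt.
  by move/negP.
by move=> /negP.
Qed.

Lemma mu_ray_lower a :
  mu (`]-oo, a]%classic `&` ~` H) = (Num.min (F a) 2^-1)%:E.
Proof.
have [Fa|Fa] := ltP (F a) 2^-1.
  rewrite -mu_ray; congr (mu _); apply/seteqP; split=> x /=; first by case.
  rewrite in_itv/= => xa; split=> //; rewrite /H /upper_half /= => /(lt_trans Fa).
  by apply/negP; rewrite -leNgt chain_cdf_homo.
(* Equality needs its own case: the ray then lies in the lower half, but the lower half may extend
   beyond [a] along a flat stretch. Only for [F a] above 1/2 is the lower half surely inside the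
   ray. *)
have [Fa2|Fa2] := eqVneq (F a) 2^-1.
  rewrite -Fa2 -mu_ray; congr (mu _); apply/seteqP; split=> x /=; first by case.
  rewrite in_itv/= => xa; split=> //; rewrite /H /upper_half /= -Fa2.
  by apply/negP; rewrite -leNgt chain_cdf_homo.
rewrite -mu_lower_half; congr (mu _); apply/seteqP; split=> x /=; first by case.
move=> Hx; split=> //; rewrite in_itv/= leNgt; apply/negP => ax; apply: Hx.
by rewrite /H /upper_half /= (lt_le_trans _ (chain_cdf_homo (ltW ax)))// lt_neqAle eq_sym Fa2.
Qed.

(** The ray has mass [F a], of which the smaller of [F a] and 1/2 lies in the lower half; the
    difference of the two shares is [tentE]. This turns the lambda term of the copula into a product
    of signed masses. *)
Lemma smass_ray a : smass mu H `]-oo, a]%classic = tent (F a).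
Proof.
have := fine_splitE mu mH (measurable_itv `]-oo, a]).
rewrite /smass mu_ray mu_ray_lower /= -tentE => FE; congr (_ - _).
apply: (addIr (Num.min (F a) 2^-1)); rewrite -FE.
have [Fa|Fa] := leP (F a) 2^-1.
- by rewrite (max_idPl _) ?add0r// subr_le0.
- by rewrite (max_idPr _) ?subrK// subr_ge0 ltW.
Qed.

Lemma chain_step n : joint_dep mu H lambda (X n) (X n.+1).
Proof.
apply: joint_dep_ext => // x y.
have /andP[Fx0 _] := chain_cdf01 x; have /andP[Fy0 _] := chain_cdf01 y.
by rewrite chain_pair_le sign_copulaE// /dep !smass_ray !mu_ray.
Qed.

End chain_law.

(** * The n-step law by the Markov property *)

Section chain_dependence.
Context {R : realType} (lambda : R) (F : R -> R).
Context d (T : measurableType d) (P : probability T R).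
Variable X : nat -> {RV P >-> R}.
Hypothesis lambda1 : `|lambda| <= 1.
Hypothesis chainX : copula_chain (sign_copula lambda) F X.

Let H := upper_half F.
Let mu : probability R R := distribution P (X 0).
Let mH : measurable H := measurable_upper_half chainX.

Lemma fine_mu_lower : fine (mu (~` H)) = 2^-1.
Proof. by rewrite (mu_lower_half chainX). Qed.

Lemma fine_mu_upper : fine (mu H) = 2^-1.
Proof.
have := fine_splitE mu mH (@measurableT _ R).
rewrite !setTI probability_setT fine_mu_lower /= => E; lra.
Qed.

Lemma smass_upper : smass mu H H = 2^-1.
Proof. by rewrite /smass setIid setICr measure0 subr0 fine_mu_upper. Qed.

Lemma smass_lower : smass mu H (~` H) = - 2^-1.
Proof. by rewrite /smass setIid setICl measure0 sub0r fine_mu_lower. Qed.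

Lemma dep_upper c A : dep mu H c A H = fine (mu A) / 2 + c * smass mu H A / 2.
Proof. by rewrite /dep smass_upper fine_mu_upper; ring. Qed.

Lemma dep_lower c A :
  dep mu H c A (~` H) = fine (mu A) / 2 - c * smass mu H A / 2.
Proof. by rewrite /dep smass_lower fine_mu_lower; ring. Qed.

(** The preimages of Borel sets under one variable already form a sigma-algebra. *)
Lemma sigma_of_single n D : sigma_of X [set n] D ->
  exists2 A, measurable A & D = X n @^-1` A.
Proof.
have sA := sigma_algebra_preimage setT (X n) (sigma_algebra_measurable R).
move=> /(_ _ (conj sA _)) [|A mA <-]; last by exists A; rewrite ?setTI.
by move=> _ [i [B [-> mB ->]]]; exists B => //; rewrite setTI.
Qed.

Lemma sigma_of_gen (J : set nat) i B : J i -> measurable B ->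
  sigma_of X J (X i @^-1` B).
Proof. by move=> Ji mB; apply: sub_sigma_algebra; exists i, B. Qed.

(* Given which of H and ~H contains X_n, the law of Z has density 1 + c on that
   half and 1 - c on the other. *)
Lemma is_cond_prob_two_valued n (Z : {RV P >-> R}) c B :
  joint_dep mu H c (X n) Z -> (forall A, measurable A -> P (X n @^-1` A) = mu A) ->
  measurable B ->
  is_cond_prob P (sigma_of X [set n]) (Z @^-1` B)
    (fun w => (if w \in X n @^-1` H then fine (mu B) + c * smass mu H B
               else fine (mu B) - c * smass mu H B)%:E).
Proof.
move=> XZ Xn mB.
set a := _ + c * _; set b := _ - c * _.
have mXH : measurable (X n @^-1` H) := measurable_funPTI (X n) mH.
split.
- move=> V mV; rewrite [X in sigma_of _ _ X](_ : _ =
    X n @^-1` ((fun x => (if x \in H then a else b)%:E) @^-1` V))//.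
  apply: (@sigma_of_gen [set n] n) => //; rewrite -[X in measurable X]setTI.
  have := measurable_two_valued a b mH.
  by move=> /measurable_EFinP; exact.
- exact: integrable_two_valued.
move=> _ /sigma_of_single[A mA ->]; have mXA := measurable_funPTI (X n) mA.
rewrite integral_two_valued// XZ// depE//.
rewrite -preimage_setI preimage_setC -preimage_setI !Xn//.
- congr (_%:E); rewrite /a /b (fine_splitE _ mH mB) /smass; ring.
- by apply: measurableI => //; exact: measurableC.
- exact: measurableI.
Qed.

Lemma chain_dep n : joint_dep mu H (lambda ^+ n.+1) (X 0) (X n.+1).
Proof.
elim: n => [|n IH]; first by rewrite expr1; exact: (chain_step lambda1 chainX 0).
move=> A B mA mB.
have [markov _ _ _] := chainX; have [h [hc h1]] := markov n.+1 B mB.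
have hg := is_cond_prob_two_valued (chain_step lambda1 chainX n.+1)
  (chain_same_law chainX n.+1) mB.
have mXA := measurable_funPTI (X 0) mA.
have mXB := measurable_funPTI (X n.+2) mB.
have mXH := measurable_funPTI (X n.+1) mH.
(* [h] plays two roles: as a version given the past it turns the joint probability into an integral
   over the event of [X 0]; as a version given [X n.+1] it can be exchanged for the two-valued
   function. *)
have [_ _ <-] := hc; last exact: (@sigma_of_gen _ 0).
rewrite (cond_prob_unique _ mXB h1 hg)//; last first.
  by move=> _ [i [V [_ mV ->]]]; exact: measurable_funPTI.
(* Only the joint masses of [A] with the two halves remain. They are mu(A)/2 plus or minus
   lambda^(n+1) m(A)/2, and weighting them by mu(B) plus or minus lambda m(B) cancels the cross
   terms. *)
rewrite integral_two_valued// preimage_setC !IH//; last exact: measurableC.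
rewrite dep_upper dep_lower /dep (exprS _ n.+1); congr (_%:E).
set a := fine (mu A); by set b := fine (mu B) => /=; field.
Qed.

Lemma joint_chainE n A B : measurable A -> measurable B ->
  joint X n.+1 A B =
  marg X A * marg X B + lambda ^+ n.+1 * (smass mu H A * smass mu H B).
Proof. by move=> mA mB; rewrite /joint chain_dep. Qed.

Lemma smass_le_marg A : measurable A -> `|smass mu H A| <= marg X A.
Proof. exact: (smass_le mu mH). Qed.

End chain_dependence.

(** * Convergence criteria for the coefficients *)

Section coefficient_limits.
Context {R : realType}.
Implicit Types (u : nat -> \bar R) (r e : R).

Lemma cvg_geometric_EFin r : `|r| < 1 ->
  (fun n => (`|r| ^+ n)%:E) @ \oo --> (0%:E : \bar R).
Proof. by move=> r1; apply: cvg_EFin; [near=> n|apply: cvg_expr; rewrite normr_id].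
Unshelve. all: by end_near. Qed.

Lemma cvg0_of_geometric_bound u r : `|r| < 1 ->
  (forall n, 0 <= u n.+1 <= (`|r| ^+ n.+1)%:E)%E -> u @ \oo --> (0 : \bar R).
Proof.
move=> r1 ub; apply: squeeze_cvge (cvg_cst 0%E) (cvg_geometric_EFin r1).
by near=> n; rewrite -(@prednK n) ?ub//; near: n; exists 1%N.
Unshelve. all: by end_near. Qed.

Lemma cvg1_of_geometric_bound u r : `|r| < 1 ->
  (forall n, (1 - `|r| ^+ n.+1)%:E <= u n.+1 <= 1)%E ->
  u @ \oo --> (1%:E : \bar R).
Proof.
move=> r1 ub.
apply: (@squeeze_cvge _ _ _ _ (fun n => (1 - `|r| ^+ n)%:E) _ (cst 1%E)).
- by near=> n; rewrite -(@prednK n) ?ub//; near: n; exists 1%N.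
- apply: cvg_EFin; first by near=> n.
  rewrite -[X in _ --> X]subr0; apply: cvgB; first exact: cvg_cst.
  by apply: cvg_expr; rewrite normr_id.
- exact: cvg_cst.
Unshelve. all: by end_near. Qed.

Lemma not_cvg0_of_ge u e : 0 < e -> (forall n, e%:E <= u n.+1)%E ->
  ~ (u @ \oo --> (0 : \bar R)).
Proof.
move=> e0 ue u0; suff : (e%:E <= 0)%E by rewrite lee_fin leNgt e0.
apply: cvge_ge u0; near=> n; rewrite -(@prednK n) ?ue//; near: n; by exists 1%N.
Unshelve. all: by end_near. Qed.

Lemma not_cvg1_of_le0 u : (forall n, u n.+1 <= 0)%E ->
  ~ (u @ \oo --> (1%:E : \bar R)).
Proof.
move=> ue u1; suff : (1%:E <= 0 :> \bar R)%E by rewrite lee_fin leNgt ltr01.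
apply: cvge_le u1; near=> n; rewrite -(@prednK n) ?ue//; near: n; by exists 1%N.
Unshelve. all: by end_near. Qed.

End coefficient_limits.

(** * psi-, psi'- and phi-mixing *)

Section uniform_mixing.
Context {R : realType} (lambda : R) (F : R -> R).
Context d (T : measurableType d) (P : probability T R).
Variable X : nat -> {RV P >-> R}.
Hypothesis lambda1 : `|lambda| <= 1.
Hypothesis chainX : copula_chain (sign_copula lambda) F X.

Let H := upper_half F.
Let mu : probability R R := distribution P (X 0).
Let mH : measurable H := measurable_upper_half chainX.

Lemma marg_setT : marg X setT = 1.
Proof. by rewrite /marg preimage_setT probability_setT. Qed.

Lemma joint_setT n : joint X n setT setT = 1.
Proof. by rewrite /joint !preimage_setT setIT probability_setT. Qed.

Lemma marg_ge0 A : 0 <= marg X A.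
Proof. exact: fine_ge0. Qed.

Lemma marg_le1 A : measurable A -> marg X A <= 1.
Proof.
move=> mA; have mXA := measurable_funPTI (X 0) mA.
by rewrite -lee_fin /marg fineK ?fin_num_measure ?probability_le1.
Qed.

(** The bound is relative to the product of the marginals: dividing by it gives psi and psi', and
    phi follows because [marg X B] is at most 1. *)
Lemma joint_chain_dist n A B : measurable A -> measurable B ->
  `|joint X n.+1 A B - marg X A * marg X B| <=
  `|lambda| ^+ n.+1 * (marg X A * marg X B).
Proof.
move=> mA mB; rewrite (joint_chainE lambda1 chainX)// addrAC subrr add0r.
rewrite !normrM normrX ler_wpM2l ?exprn_ge0//.
by rewrite ler_pM// (smass_le_marg chainX).
Qed.

Let marg_pos A B : 0 < marg X A * marg X B -> 0 < marg X A /\ 0 < marg X B.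
Proof.
move=> AB; have A0 : 0 < marg X A.
  by rewrite lt_neqAle marg_ge0 eq_sym andbT; apply: contraTneq AB => ->;
     rewrite mul0r ltxx.
by split=> //; rewrite pmulr_rgt0 in AB.
Qed.

Lemma psi_coef_chain n : (0 <= psi_coef X n.+1 <= (`|lambda| ^+ n.+1)%:E)%E.
Proof.
(* The pair [setT], [setT] is admissible, so the supremum is not that of an empty set. *)
apply/andP; split.
  apply: (@le_trans _ _ (`|joint X n.+1 setT setT - marg X setT * marg X setT| /
    (marg X setT * marg X setT))%:E).
    by rewrite lee_fin divr_ge0// mulr_ge0 ?marg_ge0.
  apply: ereal_sup_ubound; exists setT, setT; split=> //.
  by rewrite marg_setT mulr1.
apply: ge_ereal_sup => _ [A [B [mA mB AB ->]]].
by rewrite lee_fin ler_pdivrMr// joint_chain_dist.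
Qed.

Lemma psi'_coef_chain n :
  ((1 - `|lambda| ^+ n.+1)%:E <= psi'_coef X n.+1 <= 1)%E.
Proof.
apply/andP; split; last first.
  rewrite (_ : 1%E = (joint X n.+1 setT setT / (marg X setT * marg X setT))%:E).
    apply: ereal_inf_lbound; exists setT, setT; split=> //.
    by rewrite marg_setT mulr1.
  by rewrite joint_setT marg_setT mulr1 divr1.
apply: le_ereal_inf_tmp => _ [A [B [mA mB AB ->]]].
rewrite lee_fin ler_pdivlMr//.
have := joint_chain_dist n mA mB; rewrite ler_norml => /andP[+ _].
by rewrite mulrBl mul1r lerBrDl.
Qed.

Lemma phi_coef_chain n : (0 <= phi_coef X n.+1 <= (`|lambda| ^+ n.+1)%:E)%E.
Proof.
apply/andP; split.
  apply: (@le_trans _ _ `|joint X n.+1 setT setT / marg X setT - marg X setT|%:E).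
    by rewrite lee_fin.
  apply: ereal_sup_ubound; exists setT, setT; split=> //.
  by rewrite marg_setT mulr1.
apply: ge_ereal_sup => _ [A [B [mA mB AB ->]]].
have [A0 B0] := marg_pos AB.
rewrite lee_fin -(ler_pM2l A0) -{1}(gtr0_norm A0) -normrM mulrBr.
rewrite mulrC divfK ?gt_eqF// (le_trans (joint_chain_dist _ mA mB))//.
rewrite mulrCA ler_wpM2l ?marg_ge0// ler_piMr//; exact: marg_le1.
Qed.

Lemma psi_mixing_chain : `|lambda| < 1 -> psi_mixing X.
Proof. by move=> l1; apply: cvg0_of_geometric_bound l1 psi_coef_chain. Qed.

Lemma psi'_mixing_chain : `|lambda| < 1 -> psi'_mixing X.
Proof. by move=> l1; apply: cvg1_of_geometric_bound l1 psi'_coef_chain. Qed.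

Lemma phi_mixing_chain : `|lambda| < 1 -> phi_mixing X.
Proof. by move=> l1; apply: cvg0_of_geometric_bound l1 phi_coef_chain. Qed.

Lemma marg_upper : marg X H = 2^-1.
Proof. exact: (fine_mu_upper chainX). Qed.

Lemma marg_lower : marg X (~` H) = 2^-1.
Proof. exact: (fine_mu_lower chainX). Qed.

Lemma joint_upper n : joint X n.+1 H H = (1 + lambda ^+ n.+1) / 4.
Proof.
rewrite (joint_chainE lambda1 chainX)// marg_upper (smass_upper chainX).
by field.
Qed.

Lemma joint_upper_lower n : joint X n.+1 H (~` H) = (1 - lambda ^+ n.+1) / 4.
Proof.
have mHC := measurableC mH.
rewrite (joint_chainE lambda1 chainX)// marg_upper marg_lower.
by rewrite (smass_upper chainX) (smass_lower chainX); field.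
Qed.

Hypothesis lambda_unit : `|lambda| = 1.

Let norm_lambdaX n : `|lambda ^+ n| = 1.
Proof. by rewrite normrX lambda_unit expr1n. Qed.

Lemma not_psi_mixing_chain : ~ psi_mixing X.
Proof.
(* On [H], [H] the deviation is lambda^(n+1)/4 and the product of marginals is 1/4, so the ratio has
   absolute value 1. *)
apply: (@not_cvg0_of_ge _ _ 1) => // n; apply: ereal_sup_ubound.
exists H, H; split=> //; rewrite ?joint_upper marg_upper; first by lra.
congr (_%:E); rewrite (_ : _ - _ = lambda ^+ n.+1 * 4^-1); last by field.
by rewrite normrM norm_lambdaX gtr0_norm; lra.
Qed.

Lemma not_phi_mixing_chain : ~ phi_mixing X.
Proof.
(* Here the same deviation is divided by [marg X H] = 1/2 alone. *)
apply: (@not_cvg0_of_ge _ _ 2^-1) => // n; apply: ereal_sup_ubound.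
exists H, H; split=> //; rewrite ?joint_upper marg_upper; first by lra.
congr (_%:E); rewrite (_ : _ - _ = lambda ^+ n.+1 * 2^-1); last by field.
by rewrite normrM norm_lambdaX gtr0_norm; lra.
Qed.

Lemma not_psi'_mixing_chain : ~ psi'_mixing X.
Proof.
have mHC := measurableC mH.
apply: not_cvg1_of_le0 => n; apply: ereal_inf_lbound.
(* If the power is 1 the chain never passes from [H] to its complement at this lag; if it is -1 it
   never passes from [H] to [H]. Either way some ratio is 0. *)
have /eqP := norm_lambdaX n.+1; rewrite eqr_norml ler01 andbT => /orP[|] /eqP ln.
- exists H, (~` H); split=> //; rewrite ?joint_upper_lower marg_upper marg_lower.
    lra.
  by rewrite ln subrr !mul0r.
- exists H, H; split=> //; rewrite ?joint_upper marg_upper; first lra.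
  by rewrite ln subrr !mul0r.
Qed.

End uniform_mixing.

(** * Integrals against the joint law *)

Section joint_integral.
Context {R : realType} d (T : measurableType d) (P : probability T R).
Variables (mu : probability R R) (H : set R).
Hypothesis mH : measurable H.
Variables (Y Z : {RV P >-> R}) (c : R).
Hypothesis c1 : `|c| <= 1.
Hypothesis YZ : joint_dep mu H c Y Z.

Let finH A : measurable A -> (mu A < +oo)%E.
Proof. by move=> mA; rewrite -ge0_fin_numE// fin_num_measure. Qed.

Let upper : {finite_measure set R -> \bar R} := mfrestr mH (finH mH).
Let lower : {finite_measure set R -> \bar R} :=
  mfrestr (measurableC mH) (finH (measurableC mH)).
Let half (b : bool) := if b then upper else lower.

Let halfE b A : half b A = mu (A `&` (if b then H else ~` H)).
Proof. by case: b. Qed.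

Definition half_integral (b : bool) (f : R -> \bar R) := (\int[half b]_x f x)%E.

Lemma half_integral_ge0 b f : (forall x, 0 <= f x)%E -> (0 <= half_integral b f)%E.
Proof. by move=> f0; exact: integral_ge0. Qed.

Lemma half_integralD f : measurable_fun setT f -> (forall x, 0 <= f x)%E ->
  (half_integral true f + half_integral false f = \int[mu]_x f x)%E.
Proof.
move=> mf f0; rewrite /half_integral -ge0_integral_measure_add//.
apply: eq_measure_integral => A mA _.
transitivity (mu (A `&` H) + mu (A `&` ~` H))%E; first exact: measure_addE.
have mAH := measurableI _ _ mA mH.
have mAC := measurableI _ _ mA (measurableC mH).
by rewrite -measureU//= ?setUIDK// setIACA setICr setI0.
Qed.

Let cp : 0 <= 1 + c. Proof. by move: c1; rewrite ler_norml => /andP[]; lra. Qed.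
Let cm : 0 <= 1 - c. Proof. by move: c1; rewrite ler_norml => /andP[]; lra. Qed.

(** The candidate law of the pair (Y, Z), with the diagonal and the off-diagonal blocks grouped by
    weight so that Tonelli applies block by block. *)
Let pair_law : {measure set (R * R) -> \bar R} :=
  measure_add
    (mscale (NngNum cp) (measure_add (half true \x half true)%E
                                     (half false \x half false)%E))
    (mscale (NngNum cm) (measure_add (half true \x half false)%E
                                     (half false \x half true)%E)).

Let pair_lawE A B : measurable A -> measurable B ->
  pair_law (A `*` B) = P (Y @^-1` A `&` Z @^-1` B).
Proof.
move=> mA mB; rewrite YZ// (depE mu mH c mA mB).
have fineE b C : measurable C -> half b C =
    (fine (mu (C `&` (if b then H else ~` H))))%:E.
  move=> mC; rewrite halfE fineK// fin_num_measure//.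
  by apply: measurableI => //; case: b => //; exact: measurableC.
have prodE b b' := product_measure1E (half b) (half b') mA mB.
have addE b1 b1' b2 b2' :
    measure_add (half b1 \x half b1')%E (half b2 \x half b2')%E (A `*` B) =
    (half b1 A * half b1' B + half b2 A * half b2' B)%E.
  by rewrite measure_addE; congr (_ + _)%E; exact: prodE.
transitivity ((1 + c)%:E * (half true A * half true B + half false A * half false B) +
  (1 - c)%:E * (half true A * half false B + half false A * half true B))%E.
  by rewrite -!addE; exact: measure_addE.
rewrite (fineE true _ mA) (fineE false _ mA) (fineE true _ mB) (fineE false _ mB).
set p := fine _; set q := fine _; set r := fine _; set t := fine _.
transitivity ((1 + c) * (p * q + r * t) + (1 - c) * (p * t + r * q))%:E => //.
by congr (_%:E); rewrite -/p -/q -/r -/t; ring.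
Qed.

Let YZ_fun w := (Y w, Z w).

Let mYZ : measurable_fun setT YZ_fun.
Proof. exact: measurable_fun_pair. Qed.

Let pair_law_unique : forall V, measurable V ->
  pushforward P YZ_fun V = pair_law V.
Proof.
pose m1 : {measure set (R * R) -> \bar R} := pushforward P YZ_fun.
pose G : set (set (R * R)) :=
  [set C | exists A B, [/\ measurable A, measurable B & C = A `*` B]].
apply: (@measure_unique _ _ _ G (fun=> setT) _ _ _ _ (m1 mYZ) pair_law).
- rewrite measurable_prod_measurableType; congr (<<s _ >>).
  apply/seteqP; split=> [C [A mA [B mB <-]]|C [A [B [mA mB ->]]]].
    by exists A, B.
  by exists A => //; exists B.
- move=> _ _ [A [B [mA mB ->]]] [A' [B' [mA' mB' ->]]].
  by rewrite -setXI; exists (A `&` A'), (B `&` B'); split=> //; exact: measurableI.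
- by move=> _; exists setT, setT; split=> //; rewrite setXTT.
- by rewrite bigcup_const//; exists 0%N.
- by move=> _ [A [B [mA mB ->]]]; rewrite pair_lawE.
- by move=> _; rewrite /= /pushforward preimage_setT probability_setT ltry.
Qed.

(** On each block the integral factors. Nonnegativity is what Tonelli asks for; signed functions are
    treated later through their positive and negative parts. *)
Lemma joint_integral (f g : R -> \bar R) :
  measurable_fun setT f -> measurable_fun setT g ->
  (forall x, 0 <= f x)%E -> (forall x, 0 <= g x)%E ->
  (\int[P]_w (f (Y w) * g (Z w)) =
   (1 + c)%:E * (half_integral true f * half_integral true g +
                 half_integral false f * half_integral false g) +
   (1 - c)%:E * (half_integral true f * half_integral false g +
                 half_integral false f * half_integral true g))%E.
Proof.
move=> mf mg f0 g0; pose k (z : R * R) := (f z.1 * g z.2)%E.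
have mk : measurable_fun setT k.
  by apply: emeasurable_funM; [exact: measurableT_comp mf _|exact: measurableT_comp mg _].
have k0 z : (0 <= k z)%E by rewrite /k mule_ge0.
have prodE b b' : (\int[half b \x half b']_z k z =
    half_integral b f * half_integral b' g)%E.
  rewrite fubini_tonelli1//=.
  transitivity (\int[half b]_x (f x * half_integral b' g))%E.
    apply: eq_integral => x _; rewrite /fubini_F /half_integral /k.
    by rewrite -ge0_integralZl.
  by apply: ge0_integralZr => //; exact: half_integral_ge0.
transitivity (\int[pair_law]_z k z)%E.
  pose m1 : {measure set (R * R) -> \bar R} := pushforward P YZ_fun.
  transitivity (\int[m1 mYZ]_z k z)%E; first by rewrite ge0_integral_pushforward.
  by apply: eq_measure_integral => V mV _; exact: pair_law_unique.
rewrite /pair_law ge0_integral_measure_add// !ge0_integral_mscale//.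
by rewrite !ge0_integral_measure_add// !prodE.
Qed.

End joint_integral.

(** * The bound on the maximal correlation *)

Section maximal_correlation.
Context {R : realType} d (T : measurableType d) (P : probability T R).
Variables (H : set R) (Y Z : {RV P >-> R}) (c : R).
Let mu : probability R R := distribution P Y.
Hypothesis mH : measurable H.
Hypothesis c1 : `|c| <= 1.
Hypothesis YZ : joint_dep mu H c Y Z.

Let half_integral_law (u : R -> R) : measurable_fun setT u ->
  (forall x, 0 <= u x) ->
  (half_integral mu mH true (EFin \o u) + half_integral mu mH false (EFin \o u) =
   \int[P]_w (u (Y w))%:E)%E.
Proof.
move=> muu u0; rewrite half_integralD//; last exact/measurable_EFinP.
rewrite /mu ge0_integral_pushforward//.
  exact/measurable_EFinP.
by move=> x _; rewrite /= lee_fin.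
Qed.

(* Split f into positive and negative parts and integrate both over the two
   halves: E f = 0 leaves only c times a square, which is at most (E |f|)^2. *)
Lemma expectation_mul_le (f : R -> R) : measurable_fun setT f ->
  'E_P[fun w => (f (Y w))%R]%E = 0%E -> 'E_P[fun w => (f (Y w) ^+ 2)%R]%E = 1%E ->
  (`|'E_P[fun w => (f (Y w) * f (Z w))%R]| <= `|c|%:E)%E.
Proof.
move=> mf; rewrite !unlock => Ef Ef2.
pose p x := Num.max (f x) 0; pose q x := Num.max (- f x) 0.
have mp : measurable_fun setT p by exact: measurable_maxr.
have mq : measurable_fun setT q by apply: measurable_maxr => //; exact: measurable_funN.
have p0 x : 0 <= p x by rewrite /p le_max lexx orbT.
have q0 x : 0 <= q x by rewrite /q le_max lexx orbT.
have pq x : (p x = f x /\ q x = 0) \/ (p x = 0 /\ q x = - f x).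
  have [fx|fx] := leP 0 (f x); [left|right]; split.
  - exact/max_idPl.
  - by apply/max_idPr; rewrite oppr_le0.
  - by apply/max_idPr; exact: ltW.
  - by apply/max_idPl; rewrite oppr_ge0 ltW.
have fpq x : f x = p x - q x.
  by case: (pq x) => -[-> ->]; rewrite ?subr0// opprK add0r.
(* The inequality 2|f| <= 1 + f^2 gives E|f| <= 1 from E f^2 = 1, in place of Cauchy-Schwarz. *)
have fabs x : 2 * (p x + q x) <= 1 + f x ^+ 2.
  have pq0 : p x * q x = 0 by case: (pq x) => -[-> ->]; rewrite ?mulr0 ?mul0r.
  rewrite fpq sqrrB pq0 mul0rn subr0 -subr_ge0.
  rewrite (_ : _ - _ = (1 - (p x + q x)) ^+ 2 - 2 * (p x * q x)); last by ring.
  by rewrite pq0 mulr0 subr0 sqr_ge0.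
have mY : measurable_fun setT (Y : T -> R) by [].
have mZ : measurable_fun setT (Z : T -> R) by [].
have mpY : measurable_fun setT (p \o Y) by exact: measurableT_comp.
have mqY : measurable_fun setT (q \o Y) by exact: measurableT_comp.
have pq1 : (\int[P]_w (p (Y w))%:E + \int[P]_w (q (Y w))%:E <= 1)%E.
  rewrite -ge0_integralD//; last 4 first.
  - by move=> w _; rewrite lee_fin.
  - exact/measurable_EFinP.
  - by move=> w _; rewrite lee_fin.
  - exact/measurable_EFinP.
  have mfY2 : measurable_fun setT (fun w => f (Y w) ^+ 2).
    by apply: measurable_funX; exact: measurableT_comp.
  have : (\int[P]_w (2%:E * ((p (Y w))%:E + (q (Y w))%:E)) <= 2%:E)%E.
    rewrite [leRHS](_ : _ = \int[P]_w (1%:E + (f (Y w) ^+ 2)%:E))%E; last first.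
      rewrite ge0_integralD//; first by rewrite Ef2 integral_cst// [X in (_ * X + _)%E]probability_setT mule1.
      - by move=> w _; rewrite lee_fin sqr_ge0.
      - exact/measurable_EFinP.
    apply: ge0_le_integral => //.
    - by move=> w _; rewrite -EFinD -EFinM lee_fin mulr_ge0// addr_ge0.
    - apply/measurable_EFinP; apply: measurable_funM => //.
      exact: measurable_funD.
    - by apply/measurable_EFinP; exact: measurable_funD.
    - by move=> w _; rewrite -EFinD -EFinM lee_fin fabs.
  rewrite ge0_integralZl//.
  - by rewrite -[X in (_ <= X)%E]mule1 lee_pmul2l ?lte_fin.
  - by apply/measurable_EFinP; exact: measurable_funD.
  - by move=> w _; rewrite -EFinD lee_fin addr_ge0.
have half0 b u : (forall x, 0 <= u x) -> (0 <= half_integral mu mH b (EFin \o u))%E.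
  by move=> u0; apply: half_integral_ge0 => x; rewrite lee_fin.
have halfp := half_integral_law mp p0.
have halfq := half_integral_law mq q0.
(* Each half integral is at most E|f| <= 1, so the rest of the computation can be done with real
   numbers. *)
have fin b : half_integral mu mH b (EFin \o p) \is a fin_num /\
             half_integral mu mH b (EFin \o q) \is a fin_num.
  have pp := half0 _ _ p0; have qq := half0 _ _ q0.
  have Ip0 : (0 <= \int[P]_w (p (Y w))%:E)%E by rewrite -halfp adde_ge0.
  have Iq0 : (0 <= \int[P]_w (q (Y w))%:E)%E by rewrite -halfq adde_ge0.
  have Ip1 : (\int[P]_w (p (Y w))%:E < +oo)%E.
    by rewrite (le_lt_trans (le_trans (leeDl _ Iq0) pq1))// ltry.
  have Iq1 : (\int[P]_w (q (Y w))%:E < +oo)%E.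
    by rewrite (le_lt_trans (le_trans (leeDr _ Ip0) pq1))// ltry.
  rewrite !ge0_fin_numE//; split.
  - apply: le_lt_trans Ip1; rewrite -halfp.
    by case: b; [exact: leeDl|exact: leeDr].
  - apply: le_lt_trans Iq1; rewrite -halfq.
    by case: b; [exact: leeDl|exact: leeDr].
pose I b u := fine (half_integral mu mH b (EFin \o u)).
have I0 b u : (forall x, 0 <= u x) -> 0 <= I b u by move=> u0; rewrite fine_ge0// half0.
have IE b u : u = p \/ u = q -> half_integral mu mH b (EFin \o u) = (I b u)%:E.
  by move=> [->|->]; rewrite fineK//; have [] := fin b.
have J u v : u = p \/ u = q -> v = p \/ v = q ->
    (\int[P]_w (u (Y w) * v (Z w))%:E = ((1 + c) * (I true u * I true v + I false u * I false v) +
      (1 - c) * (I true u * I false v + I false u * I true v))%:E)%E.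
  move=> hu hv.
  have mu' : measurable_fun setT u by case: hu => ->.
  have mv' : measurable_fun setT v by case: hv => ->.
  have u0 x : 0 <= u x by case: hu => ->.
  have v0 x : 0 <= v x by case: hv => ->.
  have := @joint_integral _ _ _ P mu H mH Y Z c c1 YZ (EFin \o u) (EFin \o v).
  rewrite (IE true u hu) (IE false u hu) (IE true v hv) (IE false v hv).
  by apply; [exact/measurable_EFinP|exact/measurable_EFinP|..]; move=> x; rewrite /= lee_fin.
have hp : p = p \/ p = q by left.
have hq : q = p \/ q = q by right.
have fin_integrable (u : T -> R) (r : R) : measurable_fun setT u -> (forall w, 0 <= u w) ->
    (\int[P]_w (u w)%:E = r%:E)%E -> P.-integrable setT (EFin \o u).
  move=> mu0 u0 ur; apply/integrableP; split; first exact/measurable_EFinP.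
  rewrite (eq_integral (fun w => (u w)%:E)) ?ur ?ltry// => w _ /=.
  by rewrite ger0_norm.
have Ipe : (\int[P]_w (p (Y w))%:E = (I true p + I false p)%:E)%E.
  by rewrite -halfp !IE.
have Iqe : (\int[P]_w (q (Y w))%:E = (I true q + I false q)%:E)%E.
  by rewrite -halfq !IE.
have sum1 : I true p + I false p + (I true q + I false q) <= 1.
  by move: pq1; rewrite Ipe Iqe -EFinD lee_fin.
have sum0 : I true p + I false p = I true q + I false q.
  apply/eqP; rewrite -subr_eq0; apply/eqP; apply: EFin_inj.
  rewrite EFinB -Ipe -Iqe -integralB_EFin//.
  - by rewrite -[RHS]Ef; apply: eq_integral => w _; rewrite fpq EFinB.
  - exact: fin_integrable Ipe.
  - exact: fin_integrable Iqe.
(* [A] collects the terms of f(Y) f(Z) with positive sign, [B] those with negative sign; both are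
   nonnegative with finite integral. *)
pose A w := p (Y w) * p (Z w) + q (Y w) * q (Z w).
pose B w := p (Y w) * q (Z w) + q (Y w) * p (Z w).
have mpZ : measurable_fun setT (p \o Z) by exact: measurableT_comp.
have mqZ : measurable_fun setT (q \o Z) by exact: measurableT_comp.
have mA : measurable_fun setT A.
  by apply: measurable_funD; exact: measurable_funM.
have mB : measurable_fun setT B.
  by apply: measurable_funD; exact: measurable_funM.
have A0 w : 0 <= A w by rewrite addr_ge0// mulr_ge0.
have B0 w : 0 <= B w by rewrite addr_ge0// mulr_ge0.
have intD (u v : T -> R) : measurable_fun setT u -> measurable_fun setT v ->
    (forall w, 0 <= u w) -> (forall w, 0 <= v w) ->
    (\int[P]_w (u w + v w)%:E = \int[P]_w (u w)%:E + \int[P]_w (v w)%:E)%E.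
  move=> mu0 mv0 u0 v0; rewrite -ge0_integralD//; do ?exact/measurable_EFinP.
  - by move=> w _; rewrite lee_fin.
  - by move=> w _; rewrite lee_fin.
have := intD (fun w => p (Y w) * p (Z w)) (fun w => q (Y w) * q (Z w)).
rewrite (J p p)// (J q q)// -EFinD => IA.
have := intD (fun w => p (Y w) * q (Z w)) (fun w => q (Y w) * p (Z w)).
rewrite (J p q)// (J q p)// -EFinD => IB.
have {}IA := IA (measurable_funM mpY mpZ) (measurable_funM mqY mqZ)
  (fun w => mulr_ge0 (p0 _) (p0 _)) (fun w => mulr_ge0 (q0 _) (q0 _)).
have {}IB := IB (measurable_funM mpY mqZ) (measurable_funM mqY mpZ)
  (fun w => mulr_ge0 (p0 _) (q0 _)) (fun w => mulr_ge0 (q0 _) (p0 _)).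
rewrite (eq_integral (fun w => (A w)%:E - (B w)%:E)%E); last first.
  by move=> w _; rewrite -EFinB !fpq /A /B; congr (_%:E); ring.
rewrite integralB_EFin//; last 2 first.
- exact: fin_integrable IA.
- exact: fin_integrable IB.
rewrite IA IB -EFinB /= lee_fin.
have Ip0 b := I0 b _ p0; have Iq0 b := I0 b _ q0.
move: sum0 sum1 (Ip0 true) (Ip0 false) (Iq0 true) (Iq0 false).
move: (I true p) (I false p) (I true q) (I false q) => a1 a2 b1 b2 s0 s1 a10 a20 b10 b20.
(* The first square is (E f)^2 = 0. The second is that of the difference between the integrals of f
   over the two halves, which is at most E|f| <= 1 in absolute value. *)
rewrite [X in `|X|](_ : _ = (a1 + a2 - (b1 + b2)) ^+ 2 +
  c * (a1 - a2 - (b1 - b2)) ^+ 2); last by ring.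
rewrite s0 subrr expr0n add0r normrM ler_piMr// normrX -[leRHS](expr1n _ 2).
by rewrite lerXn2r ?nnegrE// ler_norml; apply/andP; split; lra.
Qed.

End maximal_correlation.

(** * rho-mixing *)

Section rho_mixing_of_chain.
Context {R : realType} (lambda : R) (F : R -> R).
Context d (T : measurableType d) (P : probability T R).
Variable X : nat -> {RV P >-> R}.
Hypothesis lambda1 : `|lambda| <= 1.
Hypothesis chainX : copula_chain (sign_copula lambda) F X.

Let H := upper_half F.
Let mu : probability R R := distribution P (X 0).
Let mH : measurable H := measurable_upper_half chainX.

(** Where F = 1/2 the value is -1 instead of 0, so that the square is identically 1. *)
Let sgn (x : R) : R := if x \in H then 1 else -1.

Let expectation_sgn : 'E_P[fun w => sgn (X 0 w)]%E = 0%E.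
Proof.
rewrite unlock; have mXH := measurable_funPTI (X 0) mH.
transitivity (\int[P]_w (if w \in X 0 @^-1` H then 1 else -1 : R)%:E)%E => //.
rewrite integral_two_valued// !setTI.
have -> : fine (P (X 0 @^-1` H)) = 2^-1 by exact: (marg_upper chainX).
have -> : fine (P (~` (X 0 @^-1` H))) = 2^-1 by exact: (marg_lower chainX).
by congr (_%:E); ring.
Qed.

Let expectation_sgn2 : 'E_P[fun w => (sgn (X 0 w) ^+ 2)%R]%E = 1%E.
Proof.
rewrite unlock (eq_integral (cst 1%E)); last first.
  by move=> w _; rewrite /sgn; case: ifP => _; rewrite ?sqrrN expr1n.
by rewrite integral_cst// [X in (_ * X)%E]probability_setT mule1.
Qed.

Let expectation_sgn_mul n :
  'E_P[fun w => (sgn (X 0 w) * sgn (X n.+1 w))%R]%E = (lambda ^+ n.+1)%:E.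
Proof.
rewrite unlock.
have mX0 := measurable_funPTI (X 0) mH.
have mXn := measurable_funPTI (X n.+1) mH.
(* [V] is the event that the two signs agree, so the expectation is P(V) - P(not V). *)
pose V := (X 0 @^-1` H `&` X n.+1 @^-1` H) `|` (~` (X 0 @^-1` H) `&` ~` (X n.+1 @^-1` H)).
have mHH := measurableI _ _ mX0 mXn.
have mLL := measurableI _ _ (measurableC mX0) (measurableC mXn).
have mV : measurable V by exact: measurableU.
rewrite (eq_integral (fun w => (if w \in V then 1 else -1 : R)%:E)); last first.
  move=> w _; congr (_%:E); rewrite /sgn.
  have [Hw|Hw] := pselect (H (X 0 w)); have [Hw'|Hw'] := pselect (H (X n.+1 w)).
  - have Vw : V w by left.
    by rewrite (mem_set Hw) (mem_set Hw') (mem_set Vw) mulr1.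
  - have Vw : ~ V w by case=> -[].
    by rewrite (mem_set Hw) (memNset Hw') (memNset Vw) mul1r.
  - have Vw : ~ V w by case=> -[].
    by rewrite (memNset Hw) (mem_set Hw') (memNset Vw) mulr1.
  - have Vw : V w by right.
    by rewrite (memNset Hw) (memNset Hw') (mem_set Vw) mulrNN mulr1.
rewrite integral_two_valued// !setTI.
have PV : fine (P V) = (1 + lambda ^+ n.+1) / 2.
  rewrite /V measureU//=; last by rewrite setIACA setICr set0I.
  rewrite fineD ?fin_num_measure//.
  have -> : fine (P (X 0 @^-1` H `&` X n.+1 @^-1` H)) = (1 + lambda ^+ n.+1) / 4.
    exact: (joint_upper lambda1 chainX).
  have -> : fine (P (~` (X 0 @^-1` H) `&` ~` (X n.+1 @^-1` H))) =
      joint X n.+1 (~` H) (~` H) by [].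
  have mHC := measurableC mH.
  rewrite (joint_chainE lambda1 chainX)// (marg_lower chainX) (smass_lower chainX).
  by field.
have -> : fine (P (~` V)) = 1 - fine (P V).
  by rewrite probability_setC// fineB ?fin_num_measure.
by rewrite PV; congr (_%:E); field.
Qed.

Let rho_ge n : ((`|lambda| ^+ n.+1)%:E <= rho_coef X n.+1)%E.
Proof.
apply: ereal_sup_ubound; exists sgn; split=> //.
- exact: measurable_two_valued.
- by rewrite expectation_sgn_mul /= normrX.
Qed.

Lemma rho_mixing_chain : `|lambda| < 1 -> rho_mixing X.
Proof.
move=> l1; apply: (cvg0_of_geometric_bound l1) => n; apply/andP; split.
  by rewrite (le_trans _ (rho_ge n))// lee_fin exprn_ge0.
apply: ge_ereal_sup => _ [f [mf Ef Ef2 ->]].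
rewrite -normrX; apply: (expectation_mul_le mH) => //.
- by rewrite normrX exprn_ile1.
- exact: (chain_dep lambda1 chainX).
Qed.

Lemma not_rho_mixing_chain : `|lambda| = 1 -> ~ rho_mixing X.
Proof.
move=> l1; apply: (@not_cvg0_of_ge _ _ 1) => // n.
by have := rho_ge n; rewrite l1 expr1n.
Qed.

End rho_mixing_of_chain.

(** * The conditional kernel at positive lag *)

Section half_kernel.
Context {R : realType} (mu : probability R R) (H : set R) (c : R).
Hypothesis mH : measurable H.
Hypothesis c1 : `|c| <= 1.

Let cp : 0 <= 1 + c. Proof. by move: c1; rewrite ler_norml => /andP[]; lra. Qed.
Let cm : 0 <= 1 - c. Proof. by move: c1; rewrite ler_norml => /andP[]; lra. Qed.

(** For [c] a positive power of lambda this is the conditional law of the chain at that lag given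
    [X 0 = x]: relative to [mu], density [1 + c] on the half containing [x] and [1 - c] on the
    other. *)
Definition half_kernel (x : R) : {measure set R -> \bar R} :=
  if x \in H then half_mix mu mH (NngNum cp) (NngNum cm)
  else half_mix mu mH (NngNum cm) (NngNum cp).

Lemma half_kernelE x B : measurable B -> half_kernel x B =
  (if x \in H then fine (mu B) + c * smass mu H B
   else fine (mu B) - c * smass mu H B)%:E.
Proof.
move=> mB; rewrite /half_kernel.
by case: ifP => _; rewrite half_mixE//= (fine_splitE mu mH mB) /smass;
  congr (_%:E); ring.
Qed.

Let half_kernel_measurable B : measurable B ->
  measurable_fun setT (half_kernel ^~ B).
Proof.
move=> mB; rewrite (_ : half_kernel ^~ B = EFin \o (fun x =>
   if x \in H then fine (mu B) + c * smass mu H B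
   else fine (mu B) - c * smass mu H B)).
  by apply/measurable_EFinP; exact: measurable_two_valued.
by apply/funext => x; rewrite half_kernelE.
Qed.

HB.instance Definition _ :=
  isKernel.Build _ _ _ _ _ half_kernel half_kernel_measurable.

Hypothesis muH : smass mu H setT = 0.

(** The halves have equal mass, so the densities [1 + c] and [1 - c] average to 1. *)
Let half_kernel_setT x : half_kernel x setT = 1%E.
Proof.
by rewrite half_kernelE// muH mulr0 addr0 subr0 probability_setT; case: ifP.
Qed.

HB.instance Definition _ :=
  Kernel_isProbability.Build _ _ _ _ _ half_kernel half_kernel_setT.

Definition half_pkernel : R.-pker R ~> R := half_kernel.

End half_kernel.

(** * beta-mixing *)

Section beta_mixing_of_chain.
Context {R : realType} (lambda : R) (F : R -> R).
Context d (T : measurableType d) (P : probability T R).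
Variable X : nat -> {RV P >-> R}.
Hypothesis lambda1 : `|lambda| <= 1.
Hypothesis chainX : copula_chain (sign_copula lambda) F X.

Let H := upper_half F.
Let mu : probability R R := distribution P (X 0).
Let mH : measurable H := measurable_upper_half chainX.

(* Unlike [ge0_le_integral], no measurability is required: the supremum in
   the definition of the coefficient ranges over an uncountable family. *)
Lemma ge0_le_integral_nonmeasurable (f g : T -> \bar R) :
  (forall w, 0 <= f w)%E -> (forall w, f w <= g w)%E ->
  (\int[P]_w f w <= \int[P]_w g w)%E.
Proof.
move=> f0 fg; have g0 w : (0 <= g w)%E := le_trans (f0 w) (fg w).
(* The integral is a supremum over simple functions below the integrand, and those below [f] are
   below [g]. *)
rewrite !ge0_integralTE//; apply: ereal_sup_le => _ [h hf <-].
by exists h => // w; exact: le_trans (hf w) (fg w).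
Qed.

Definition cond_dist (k : R.-pker R ~> R) (w : T) : \bar R :=
  ereal_sup [set `|k (X 0%N w) B - P (X 0%N @^-1` B)|%E
    | B in [set B : set R | measurable B]].

Lemma cond_dist_ge0 k w : (0 <= cond_dist k w)%E.
Proof.
apply: (@le_trans _ _ `|k (X 0%N w) setT - P (X 0%N @^-1` setT)|%E) => //.
by apply: ereal_sup_ubound; exists setT => //=; exact: measurableT.
Qed.

Let smass_setT : smass mu H setT = 0.
Proof.
rewrite /smass !setTI.
by rewrite [X in X - _](fine_mu_upper chainX) [X in _ - X](fine_mu_lower chainX) subrr.
Qed.

Let lambdaX1 n : `|lambda ^+ n| <= 1.
Proof. by rewrite normrX exprn_ile1. Qed.

(* X_0 determines itself: at lag 0 the regular version is the Dirac kernel. *)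
Let version (n : nat) : R.-pker R ~> R :=
  if n is n'.+1 then half_pkernel mH (lambdaX1 n'.+1) smass_setT
  else kdirac (@measurable_id _ R setT).

Let version_regular n : is_regular_cond X n (version n).
Proof.
case: n => [|n] B mB.
- have mXB := measurable_funPTI (X 0) mB.
  pose h w := (if w \in X 0 @^-1` B then 1 else 0 : R)%:E.
  have -> : (fun w => version 0 (X 0 w) B) = h.
    apply/funext => w; rewrite /version /= /kdirac diracE /h.
    have -> : (w \in X 0 @^-1` B) = (X 0 w \in B) by [].
    by case: (_ \in _).
  split.
  + move=> V mV; rewrite [X in sigma_of _ _ X](_ : _ =
      X 0 @^-1` ((fun x => (if x \in B then 1 else 0 : R)%:E) @^-1` V))//.
    apply: (@sigma_of_gen _ _ _ _ _ [set 0%N] 0) => //.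
    rewrite -[X in measurable X]setTI.
    by have /measurable_EFinP := measurable_two_valued (1 : R) 0 mB; exact.
  + exact: integrable_two_valued.
  + move=> _ /sigma_of_single[A mA ->].
    have mXA := measurable_funPTI (X 0) mA.
    rewrite integral_two_valued// mul1r mul0r addr0 fineK ?fin_num_measure//.
    exact: measurableI.
- rewrite (_ : (fun w => _) = (fun w => (if w \in X 0 @^-1` H
      then fine (mu B) + lambda ^+ n.+1 * smass mu H B
      else fine (mu B) - lambda ^+ n.+1 * smass mu H B)%:E)).
    apply: (is_cond_prob_two_valued chainX) => //.
    exact: (chain_dep lambda1 chainX).
  by apply/funext => w; rewrite /version /half_pkernel /= half_kernelE.
Qed.

Lemma beta_mixing_chain : `|lambda| < 1 -> beta_mixing X.
Proof.
move=> l1; exists (fun n => \int[P]_w cond_dist (version n) w)%E.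
  by move=> n; exists (version n) => //; exact: version_regular.
apply: (cvg0_of_geometric_bound l1) => n; apply/andP; split.
  by apply: integral_ge0 => w _; exact: cond_dist_ge0.
apply: (@le_trans _ _ (\int[P]_w cst (`|lambda| ^+ n.+1)%:E w)%E); last first.
  by rewrite integral_cst// [X in (_ * X)%E]probability_setT mule1.
apply: ge0_le_integral_nonmeasurable => w; first exact: cond_dist_ge0.
apply: ge_ereal_sup => _ [B mB <-].
have -> : P (X 0 @^-1` B) = (fine (mu B))%:E by rewrite fineK// fin_num_measure.
rewrite /version /half_pkernel /= half_kernelE// -EFinB lee_fin.
have sB : `|lambda ^+ n.+1 * smass mu H B| <= `|lambda| ^+ n.+1.
  rewrite normrM normrX ler_piMr ?exprn_ge0//.
  by rewrite (le_trans (smass_le mu mH mB))// (marg_le1 X).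
by case: ifP => _; rewrite addrAC subrr add0r ?normrN.
Qed.

(** The version [k] is arbitrary, so only its defining integrals can be used. Testing with [B = H]
    on the event that [X 0] lies in [H] gives P(H, H) - 1/4 = lambda^(n+1)/4, the source of the
    factor 1/4. *)
Lemma beta_coef_ge n b : is_beta_coef X n.+1 b ->
  ((`|lambda| ^+ n.+1 / 4)%:E <= b)%E.
Proof.
move=> [k kreg ->]; have mXH := measurable_funPTI (X 0) mH.
have [_ kint kE] := kreg H mH.
have P0 : P (X 0 @^-1` H) = 2^-1%:E.
  by rewrite -(fine_mu_upper chainX) fineK// fin_num_measure.
pose f w := (k (X 0 w) H - 2^-1%:E)%E.
have int2 : P.-integrable setT (cst (2^-1%:E : \bar R)).
  by apply: finite_measure_integrable_cst.
have fint : P.-integrable setT f by exact: integrableB.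
have fU : (\int[P]_(w in X 0 @^-1` H) f w = (lambda ^+ n.+1 / 4)%:E)%E.
  rewrite integralB//; [|exact: integrableS kint|exact: integrableS int2].
  rewrite kE; last exact: (@sigma_of_gen _ _ _ _ _ [set 0%N] 0).
  rewrite integral_cst// [X in (_ - _ * X)%E]P0 (chain_dep lambda1 chainX)// (dep_upper chainX).
  rewrite (smass_upper chainX) (fine_mu_upper chainX) -EFinM -EFinB.
  by congr (_%:E); field.
apply: (@le_trans _ _ (\int[P]_w `|f w|)%E).
  apply: (@le_trans _ _ (\int[P]_(w in X 0 @^-1` H) `|f w|)%E).
    apply: le_trans (le_abse_integral _ _ _) => //.
      by rewrite fU /= normrM normrX (@ger0_norm _ 4^-1)// invr_ge0.
    by apply: measurable_funTS; exact: measurable_int fint.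
  apply: ge0_subset_integral => //.
  by apply: measurableT_comp => //; exact: measurable_int fint.
apply: ge0_le_integral_nonmeasurable => // w.
by apply: ereal_sup_ubound; exists H; rewrite ?P0.
Qed.

Lemma not_beta_mixing_chain : `|lambda| = 1 -> ~ beta_mixing X.
Proof.
move=> l1 [b bX]; apply: (@not_cvg0_of_ge _ _ 4^-1) => // n.
by have := beta_coef_ge (bX n.+1); rewrite l1 expr1n mul1r.
Qed.

End beta_mixing_of_chain.

(** * Assembly of the five claims *)

Theorem mainTheorem11 (R : realType) :
  let C : R -> R -> R -> R := @sign_copula R in
  let C1 := C 1 in
  let C2 := C (-1) in
  (* C lambda is the copula with the given density *)
  (forall lambda : R, `|lambda| <= 1 ->
     is_copula (C lambda) /\ has_density (C lambda) (sign_density lambda)) /\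
  (* (1) *)
  ((forall lambda : R, `|lambda| <= 1 ->
      forall u v : R, u \in `[0, 1] -> v \in `[0, 1] ->
        C lambda u v =
          (1 + lambda) / 2 * C1 u v + (1 - lambda) / 2 * C2 u v) /\
   (forall lambda : R, `|lambda| < 1 ->
      generates (@psi_mixing R) (C lambda))) /\
  (* (2) *)
  ((~ has_density_bounded_away_from_0 C1 /\
    ~ has_density_bounded_away_from_0 C2) /\
   (generates_no (@rho_mixing R) C1 /\ generates_no (@rho_mixing R) C2) /\
   (generates_no (@psi'_mixing R) C1 /\ generates_no (@psi'_mixing R) C2) /\
   (forall lambda : R, `|lambda| < 1 ->
      generates (@psi'_mixing R) (C lambda) /\
      generates (@rho_mixing R) (C lambda))) /\
  (* (3) *)
  ((generates_no (@psi_mixing R) C1 /\ generates_no (@psi_mixing R) C2) /\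
   (forall lambda : R, `|lambda| < 1 ->
      generates (@psi_mixing R) (C lambda))) /\
  (* (4) *)
  ((generates_no (@phi_mixing R) C1 /\ generates_no (@phi_mixing R) C2) /\
   (forall lambda : R, `|lambda| < 1 ->
      generates (@phi_mixing R) (C lambda))) /\
  (* (5) *)
  ((generates_no (@beta_mixing R) C1 /\ generates_no (@beta_mixing R) C2) /\
   (forall lambda : R, `|lambda| < 1 ->
      generates (@beta_mixing R) (C lambda))).
Proof.
move=> C C1 C2.
have n1 : `|1 : R| = 1 by rewrite normr1.
have nN1 : `|- 1 : R| = 1 by rewrite normrN1.
have l1 : `|1 : R| <= 1 by rewrite n1.
have lN1 : `|- 1 : R| <= 1 by rewrite nN1.
have psi lambda : `|lambda| < 1 -> generates (@psi_mixing R) (C lambda).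
  move=> ll F _ d T P X chainX.
  exact: (psi_mixing_chain (ltW ll) chainX ll).
split.
  move=> lambda ll.
  by split; [exact: is_copula_sign_copula|exact: has_density_sign_copula].
split.
  split=> // lambda _ u v; rewrite !in_itv/= => /andP[u0 _] /andP[v0 _].
  exact: sign_copula_mix.
split.
  split.
    split; [exact: sign_copula1_not_density|exact: sign_copulaN1_not_density].
  split.
    by split=> F _ d T P X chainX;
      [exact: (not_rho_mixing_chain l1 chainX n1)
      |exact: (not_rho_mixing_chain lN1 chainX nN1)].
  split.
    by split=> F _ d T P X chainX;
      [exact: (not_psi'_mixing_chain l1 chainX n1)
      |exact: (not_psi'_mixing_chain lN1 chainX nN1)].
  move=> lambda ll; split=> F _ d T P X chainX.
    exact: (psi'_mixing_chain (ltW ll) chainX ll).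
  exact: (rho_mixing_chain (ltW ll) chainX ll).
split.
  split=> //; split=> F _ d T P X chainX.
    exact: (not_psi_mixing_chain l1 chainX n1).
  exact: (not_psi_mixing_chain lN1 chainX nN1).
split; split.
- split=> F _ d T P X chainX.
    exact: (not_phi_mixing_chain l1 chainX n1).
  exact: (not_phi_mixing_chain lN1 chainX nN1).
- move=> lambda ll F _ d T P X chainX.
  exact: (phi_mixing_chain (ltW ll) chainX ll).
- split=> F _ d T P X chainX.
    exact: (not_beta_mixing_chain l1 chainX n1).
  exact: (not_beta_mixing_chain lN1 chainX nN1).
- move=> lambda ll F _ d T P X chainX.
  exact: (beta_mixing_chain (ltW ll) chainX ll).
Qed.
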